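(* Let $0\le k\le n-2$ and let $G\in\mathfrak{H}_{n,k}$, i.e. $G$ is a connected graph on $n$ vertices with exactly $k$ pendant vertices. Then: (i) For $2\le k\le n-2$, $W(G)\le W\left(T(\lfloor \frac{k}{2}\rfloor,\lceil\frac{k}{2}\rceil,n-k)\right)$, and equality holds if and only if $G= T(\lfloor\frac{k}{2}\rfloor,\lceil \frac{k}{2}\rceil,n-k)$. Furthermore, $W\left(T(\lfloor\frac{k}{2}\rfloor,\lceil \frac{k}{2}\rceil,n-k)\right)$ equals $$\binom{n-k+1}{3}+\frac{k^2}{4}(n-k+3)+\frac{k}{2}\left[(n-k)^2+n-k-2\right]$$ if $k$ is even, and $$\binom{n-k+1}{3}+\frac{k^2-1}{4}(n-k+3)+\frac{k}{2}\left[(n-k)^2+n-k-2\right]+1$$ if $k$ is odd. (ii) For $k=1$ (and $n\ge 4$), $W(G)\le W(U_{n,3}^l)$, and equality holds if and only if $G=U_{n,3}^l$. Furthermore, $W(U_{n,3}^l)=\frac{n^3-7n+12}{6}$. (iii) For $k=0$ and $n\ge 7$, $W(G)\le W(C_{3,3}^n)$, and equality holds if and only if $G=C_{3,3}^n$. Furthermore, $W(C_{3,3}^n)=\frac{n^3-13n+24}{6}$.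
   Context: All graphs are finite, simple, connected and undirected; equality of graphs means isomorphism. The Wiener index of a connected graph $G$ is $W(G)=\sum_{\{u,v\}\subseteq V(G)}d_G(u,v)$, where the sum is over unordered pairs of vertices and $d_G$ is the shortest-path distance. A pendant vertex is a vertex of degree one. $\mathfrak{H}_{n,k}$ is the class of all connected graphs on $n$ vertices with exactly $k$ pendant vertices. $P_d$ is the path $v_1v_2\ldots v_d$ on $d$ vertices; $C_g$ is the cycle on $g$ vertices ($g\ge 3$). For positive integers $a,b,d$, $T(a,b,d)$ is the tree on $a+b+d$ vertices obtained from the path $P_d=v_1\ldots v_d$ by adding $a$ pendant vertices adjacent to $v_1$ and $b$ pendant vertices adjacent to $v_d$. For $3\le g<n$, $U_{n,g}^l$ is the graph on $n$ vertices obtained by joining, by an edge, an end vertex of the path $P_{n-g}$ to a vertex of the cycle $C_g$ (here the superscript $l$ is just a label). For integers $m_1,m_2\ge 3$ and $n\ge m_1+m_2-1$, the graph $C_{m_1,m_2}^n$ on $n$ vertices is defined as follows: if $n>m_1+m_2-1$, take a path on $n-(m_1+m_2)+2$ vertices and identify one of its end vertices with a vertex of $C_{m_1}$ and the other end vertex with a vertex of $C_{m_2}$; if $n=m_1+m_2-1$, identify one vertex of $C_{m_1}$ with one vertex of $C_{m_2}$. *)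

(* Defs.v *)
From mathcomp Require Import all_boot.

Set Implicit Arguments.
Unset Strict Implicit.
Unset Printing Implicit Defensive.

Record sgraph := SGraph {
  svertex :> finType;
  adj : rel svertex;
  adj_sym : symmetric adj;
  adj_irrefl : irreflexive adj
}.

Definition isomorphic (G H : sgraph) : Prop :=
  exists2 f : G -> H, bijective f & forall x y, adj (f x) (f y) = adj x y.

Definition connected (G : sgraph) : bool :=
  (0 < #|G|) && [forall x : G, forall y : G, connect (@adj G) x y].

Definition degree (G : sgraph) (x : G) : nat := #|[set y | adj x y]|.

Definition pendants (G : sgraph) : {set G} := [set x | degree x == 1].

(* The class $\mathfrak{H}_{n,k}$. *)
Definition graph_class (n k : nat) (G : sgraph) : Prop :=
  [/\ connected G, #|G| = n & #|pendants G| = k].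

Definition walk_of_length (G : sgraph) (l : nat) (x y : G) : bool :=
  [exists p : l.-tuple G, path (@adj G) x p && (last x p == y)].

(* The least length of a walk from x to y. Searching below #|G| suffices, as a
   shortest walk repeats no vertex; the value is #|G| if y is unreachable. *)
Definition dist (G : sgraph) (x y : G) : nat :=
  find (fun l => walk_of_length l x y) (iota 0 #|G|).

(* Comparing ranks selects each unordered pair of distinct vertices once. *)
Definition wiener (G : sgraph) : nat :=
  \sum_(u : G) \sum_(v : G | enum_rank u < enum_rank v) dist u v.

Section GraphOfArcs.
Variables (V : finType) (r : rel V).

Definition arcs_adj : rel V := fun x y => (x != y) && (r x y || r y x).

Lemma arcs_adj_sym : symmetric arcs_adj.
Proof. by move=> x y; rewrite /arcs_adj eq_sym orbC. Qed.

Lemma arcs_adj_irrefl : irreflexive arcs_adj.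
Proof. by move=> x; rewrite /arcs_adj eqxx. Qed.

Definition graph_of_arcs : sgraph := SGraph arcs_adj_sym arcs_adj_irrefl.
End GraphOfArcs.

(* T(a,b,d): 'I_d is the path v_1 ... v_d (v_{i+1} is the ordinal i), 'I_a and
   'I_b are the pendant vertices attached to v_1 and v_d respectively. *)
Definition double_broom_arc (a b d : nat) : rel ('I_d + ('I_a + 'I_b)) :=
  fun x y =>
    match x, y with
    | inl i, inl j => i.+1 == j
    | inl i, inr (inl _) => i == 0 :> nat
    | inl i, inr (inr _) => i.+1 == d
    | inr _, _ => false
    end.

Definition double_broom (a b d : nat) : sgraph :=
  graph_of_arcs (@double_broom_arc a b d).

(* U_{n,g}^l, for 3 <= g < n: the cycle is 0, ..., g - 1, the path P_{n-g} is
   g, ..., n - 1, and the edge {g - 1, g} joins them. *)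
Definition lollipop (n g : nat) : sgraph :=
  graph_of_arcs (fun i j : 'I_n =>
    (i.+1 == j) || (i == 0 :> nat) && (j.+1 == g)).

(* C_{m1,m2}^n, for m1, m2 >= 3 and n >= m1 + m2 - 1: the cycles are
   0, ..., m1 - 1 and n - m2, ..., n - 1; the path is m1 - 1, m1, ..., n - m2,
   on n - (m1 + m2) + 2 vertices, with its ends on the cycles. When
   n = m1 + m2 - 1 the path is the single vertex shared by both cycles. *)
Definition dumbbell (m1 m2 n : nat) : sgraph :=
  graph_of_arcs (fun i j : 'I_n =>
    [|| i.+1 == j,
        (i == 0 :> nat) && (j.+1 == m1)
      | (i + m2 == n) && (j.+1 == n)]).

(* Main.v *)
(** Let [h_j] be the number of vertices at distance more than [j] from [v]: then
    the transmission of [v] is the sum of the [h_j], and [h] strictly decreases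
    until it vanishes.  Deleting a non-cut vertex [v] gives
    [W(G) <= transmission v + W(G - v)], hence [W(G) <= 'C(n+1, 3)] by induction.

    Pendants present ([k >= 2]): let [H] be [G] without its pendants, on [d = n - k]
    vertices, and let [a l] be the neighbour of the pendant [l].  Distances in [G]
    are at most those in [H] plus one for each pendant end.  The sum of
    [d_H(a l, a m)] is at most [(d - 1) floor(k^2 / 2)]: deleting a non-cut vertex
    of [H] and moving the points lying on it to a neighbour costs one for each pair
    of points it separates.  Equality forces each [a l] to have the transmission of
    an end of a path, so that [H] is a path, and the ends to be balanced.

    At most one pendant: [h] cannot end with [2, 1, 0], for this would create a
    pendant at the far end, and this saving in the transmission is what is needed.
    For [k = 0], a non-cut vertex [v] of degree at least three saves enough by
    itself, and one for which [G - v] has at most one pendant saves enough together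
    with the bound for [G - v].  If neither exists, then all vertices are non-cut of
    degree two, [h] drops by two at each step, and [W(G) <= n^3 / 8]. *)
Require Import Defs.
From mathcomp Require Import all_boot all_order all_algebra.
From mathcomp Require Import zify ring.

Set Implicit Arguments.
Unset Strict Implicit.
Unset Printing Implicit Defensive.

Import Order.TTheory GRing.Theory Num.Theory.

(** * Distances *)

Section Distance.
Variable G : sgraph.
Implicit Types x y z : G.

Lemma walkP l x y :
  reflect (exists p, [/\ path (@adj G) x p, last x p = y & size p = l])
          (walk_of_length l x y).
Proof.
apply: (iffP existsP) => [[p /andP[pp /eqP lp]]|[p [pp lp sp]]].
  by exists p; rewrite size_tuple.
have sp' : size p == l by apply/eqP.
by exists (Tuple sp'); rewrite /= pp lp eqxx.
Qed.

(** A walk longer than the search range is no exception, since [find] never exceeds the length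
    [#|G|] of the list searched. *)
Lemma dist_le_walk x p : path (@adj G) x p -> dist x (last x p) <= size p.
Proof.
move=> pp; rewrite /dist leqNgt; apply/negP => lt.
have szp : size p < #|G|.
  by apply: leq_trans lt _; rewrite -[X in _ <= X](size_iota 0) find_size.
have /negP[] := negbT (before_find 0 lt).
by rewrite nth_iota // add0n; apply/walkP; exists p.
Qed.

Lemma dist_walk x y : connect (@adj G) x y ->
  exists p, [/\ path (@adj G) x p, last x p = y & size p = dist x y].
Proof.
case/connectP=> p pp ->; case: (shortenP pp) => q qq uq _ {p pp}.
have sq : size q < #|G|.
  by rewrite -[X in X <= _]/(size (x :: q)) -(card_uniqP uq) max_card.
have hs : has (fun l => walk_of_length l x (last x q)) (iota 0 #|G|).
  apply/hasP; exists (size q); first by rewrite mem_iota.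
  by apply/walkP; exists q.
have := nth_find 0 hs; rewrite has_find size_iota in hs.
by rewrite nth_iota // add0n => /walkP.
Qed.

Lemma dist_lt_card x y : connect (@adj G) x y -> dist x y < #|G|.
Proof.
case/connectP=> p pp ->; case: (shortenP pp) => q qq uq _ {p pp}.
apply: leq_ltn_trans (dist_le_walk qq) _.
by rewrite -[X in X <= _]/(size (x :: q)) -(card_uniqP uq) max_card.
Qed.

Lemma distxx x : dist x x = 0.
Proof. by apply/eqP; rewrite -leqn0; apply: (@dist_le_walk x [::]). Qed.

Lemma walk_rev x p : path (@adj G) x p ->
  exists q, [/\ path (@adj G) (last x p) q, last (last x p) q = x & size q = size p].
Proof.
move=> pp; exists (rev (belast x p)); rewrite size_rev size_belast; split=> //.
  rewrite rev_path; apply: sub_path pp => a b /=; by rewrite adj_sym.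
by case: p {pp} => //= a p; rewrite rev_cons last_rcons.
Qed.

Lemma dist_sym x y : dist x y = dist y x.
Proof.
rewrite /dist; apply: eq_find => l.
apply/walkP/walkP => -[p [pp <- <-]]; exact: walk_rev.
Qed.

Lemma dist_eq0 x y : connect (@adj G) x y -> dist x y = 0 -> x = y.
Proof. by case/dist_walk => -[|a p] [] //= _ <- <-. Qed.

Lemma dist_adj x y z : connect (@adj G) x y -> adj y z -> dist x z <= (dist x y).+1.
Proof.
case/dist_walk=> p [pp lp <-] ayz.
have := @dist_le_walk x (rcons p z); rewrite last_rcons size_rcons; apply.
by rewrite rcons_path pp lp.
Qed.

Lemma dist_pred x y m : connect (@adj G) x y -> dist x y = m.+1 ->
  exists2 z, adj z y & dist x z = m.
Proof.
move=> cxy dxy; have [p [+ + sp]] := dist_walk cxy.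
case: (lastP p) sp => [|q w]; first by rewrite dxy.
rewrite size_rcons rcons_path last_rcons dxy => -[sq] /andP[qq aw] wy.
rewrite -wy; exists (last x q) => //; apply/eqP; rewrite eqn_leq -{1}sq dist_le_walk //=.
have := @dist_adj x (last x q) w; rewrite wy dxy ltnS -wy; apply => //.
by apply/connectP; exists q.
Qed.

Lemma dist_adj1 x y : adj x y -> dist x y = 1.
Proof.
move=> axy; apply/eqP; rewrite eqn_leq (@dist_le_walk x [:: y]) /= ?axy // lt0n.
apply/eqP => /(dist_eq0 (connect1 axy)) E; by rewrite E adj_irrefl in axy.
Qed.

Lemma lipschitz_dist (f : G -> nat) x y :
  (forall a b, adj a b -> f b <= (f a).+1) -> connect (@adj G) x y ->
  f y <= f x + dist x y.
Proof.
move=> lip /dist_walk[p [+ <- <-]]; elim: p x => [|a p IH] x /=; first by lia.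
by move=> /andP[/lip ? /IH]; lia.
Qed.

End Distance.

(** Edges may collapse, so that one statement serves inclusions of induced subgraphs and maps
    folding a vertex onto a neighbour. *)
Lemma weak_hom_dist (G H : sgraph) (f : G -> H) x y :
  (forall a b, adj a b -> f a = f b \/ adj (f a) (f b)) ->
  connect (@adj G) x y ->
  connect (@adj H) (f x) (f y) /\ dist (f x) (f y) <= dist x y.
Proof.
move=> hf /dist_walk[p [pp <- <-]].
suff [q [qq lq sq]] : exists q, [/\ path (@adj H) (f x) q,
    last (f x) q = f (last x p) & size q <= size p].
  split; first by apply/connectP; exists q.
  by rewrite -lq; apply: leq_trans (dist_le_walk qq) sq.
elim: p x pp => [|a p IH] x /=; first by exists [::].
case/andP => /hf xa /IH[q [qq lq sq]]; case: xa => [->|xa].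
  by exists q; split=> //; apply: leqW.
by exists (f a :: q); rewrite /= xa.
Qed.

Lemma connectedP (G : sgraph) :
  reflect (0 < #|G| /\ forall x y : G, connect (@adj G) x y) (connected G).
Proof.
by apply: (iffP andP) => -[? /= h]; split=> //;
  [move=> x y; move/forallP/(_ x)/forallP: h; apply
  | apply/forallP => x; apply/forallP => y].
Qed.

Lemma connected_root (G : sgraph) (r : G) :
  (forall x, connect (@adj G) r x) -> connected G.
Proof.
move=> h; apply/connectedP; split; first by apply/card_gt0P; exists r.
move=> x y; apply: connect_trans (h y).
by rewrite (sym_connect_sym (@adj_sym G)).
Qed.

Section Connected.
Variable G : sgraph.
Hypothesis cG : connected G.
Implicit Types x y z : G.

Lemma conn x y : connect (@adj G) x y.
Proof. by case/connectedP: cG. Qed.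
Hint Resolve conn : core.

Lemma dist_tri x y z : dist x z <= dist x y + dist y z.
Proof.
have [p [pp lp <-]] := dist_walk (conn x y).
have [q [qq lq <-]] := dist_walk (conn y z).
have := @dist_le_walk G x (p ++ q); rewrite last_cat lp lq size_cat; apply.
by rewrite cat_path pp lp.
Qed.

Lemma dist_eq0E x y : (dist x y == 0) = (x == y).
Proof.
apply/eqP/eqP => [/dist_eq0|->]; [exact | exact: distxx].
Qed.

Lemma connect_ind (P : pred G) x y :
  (forall a b, adj a b -> P a -> P b) -> P x -> P y.
Proof.
move=> step; case/connectP: (conn x y) => p + ->.
by elim: p x => //= a p IH x /andP[/step xa /IH] + /xa; apply.
Qed.

End Connected.

Lemma weak_hom_connected (G H : sgraph) (f : G -> H) : connected G ->
  (forall a b, adj a b -> f a = f b \/ adj (f a) (f b)) ->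
  (forall y, exists x, f x = y) -> connected H.
Proof.
move=> cG hf sf; case/connectedP: (cG) => /card_gt0P[r _] _.
apply: (@connected_root _ (f r)) => y; have [x <-] := sf y.
by have [] := weak_hom_dist hf (conn cG r x).
Qed.

Lemma weak_hom_dist_le (G H : sgraph) (f : G -> H) : connected G ->
  (forall a b, adj a b -> f a = f b \/ adj (f a) (f b)) ->
  forall x y, dist (f x) (f y) <= dist x y.
Proof. by move=> cG hf x y; have [] := weak_hom_dist hf (conn cG x y). Qed.

(** Passing to ordered pairs removes the ranks from all later sums. *)
Lemma wiener_double (G : sgraph) :
  (wiener G).*2 = \sum_(u : G) \sum_(v : G) dist u v.
Proof.
have -> : \sum_(u : G) \sum_(v : G) dist u v =
  \sum_(u : G) \sum_(v : G | enum_rank u < enum_rank v) dist u v +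
  \sum_(u : G) \sum_(v : G | enum_rank v < enum_rank u) dist u v.
  rewrite -big_split; apply: eq_bigr => u _ /=.
  rewrite (bigD1 u) //= distxx add0n.
  rewrite (bigID (fun v => enum_rank u < enum_rank v)) /=; congr (_ + _).
    apply: eq_bigl => v; case: eqVneq => [->|] //; by rewrite ltnn.
  apply: eq_bigl => v; rewrite -leqNgt ltn_neqAle.
  by rewrite (inj_eq val_inj) (inj_eq enum_rank_inj).
rewrite -addnn; congr (_ + _); rewrite /wiener.
rewrite [RHS](exchange_big_dep predT) //=.
by apply: eq_bigr => u _; apply: eq_bigr => v _; rewrite dist_sym.
Qed.

(** * Transmissions by layers *)

Lemma bin2S m : 'C(m.+1, 2) = m + 'C(m, 2).
Proof. by rewrite binS bin1 addnC. Qed.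

Lemma sum_ord_recl (h : nat -> nat) N :
  \sum_(j < N.+1) h j = h 0 + \sum_(j < N) h j.+1.
Proof. by rewrite big_ord_recl. Qed.

(** Termwise [h j] is at most [m - j], and these values add up to the binomial; a total without loss
    leaves no slack in any term. *)
Lemma sum_decreasing m (h : nat -> nat) N : (forall j, h j.+1 <= (h j).-1) ->
  h 0 <= m ->
  \sum_(j < N) h j <= 'C(m.+1, 2) /\
  (\sum_(j < N) h j = 'C(m.+1, 2) -> forall j, h j = m - j).
Proof.
elim: m h N => [|m IH] h N dec h0.
  have hz j : h j = 0 by elim: j => [|j IHj]; [lia | have := dec j; lia].
  by split=> [|_ j]; rewrite ?big1 ?hz.
case: N => [|N]; first by rewrite big_ord0 bin2S; split=> //; lia.
rewrite sum_ord_recl bin2S.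
have [|le eq] := IH (fun j => h j.+1) N (fun j => dec j.+1); first by have := dec 0; lia.
split=> [|E j]; first by apply: leq_add.
case: j => [|j]; first by lia.
by rewrite eq ?subSS //; lia.
Qed.

(** The best sequence is now m, m - 1, ..., 3, 2, 0, which loses exactly the final 1. *)
Lemma sum_decreasing_fork m (h : nat -> nat) N : (forall j, h j.+1 <= (h j).-1) ->
  (forall j, h j = 2 -> h j.+1 <> 1) -> 1 < m -> h 0 <= m ->
  \sum_(j < N) h j < 'C(m.+1, 2) /\
  ((\sum_(j < N) h j).+1 = 'C(m.+1, 2) ->
   forall j, h j = if j <= m - 2 then m - j else 0).
Proof.
case: m => [|[|m]] //; elim: m h N => [|m IH] h N dec fork _ h0.
  have -> : 'C(3, 2) = 3 by [].
  case: N => [|N]; first by rewrite big_ord0; split; lia.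
  rewrite sum_ord_recl.
  have h1 : h 1 = 0 by have := dec 0; have := fork 0; lia.
  have hz j : h j.+1 = 0 by elim: j => [|j IHj]; [lia | have := dec j.+1; lia].
  rewrite big1 => [|i _]; last exact: hz.
  by split=> [|E [|j]]; rewrite ?hz /=; lia.
case: (leqP (h 0) m.+2) => h0'.
  have [le _] := sum_decreasing N dec h0'.
  by rewrite bin2S; split; lia.
case: N => [|N]; first by rewrite big_ord0 bin2S; split; lia.
have [||le eq] := IH (fun j => h j.+1) N (fun j => dec j.+1) (fun j => fork j.+1) => //.
  by have := dec 0; lia.
rewrite sum_ord_recl bin2S.
split=> [|E [|j]]; [lia|rewrite /=; lia|].
rewrite eq; last by lia.
have -> : (j.+1 <= m.+3 - 2) = (j <= m.+2 - 2) by lia.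
by rewrite subSS.
Qed.

(** The best sequence is m, m - 2, m - 4, ..., whose sum is at most (m + 1)^2 / 4. *)
Lemma sum_decreasing_by_two m (h : nat -> nat) N : (forall j, h j.+1 <= h j - 2) ->
  h 0 <= m -> 4 * \sum_(j < N) h j <= m.+1 ^ 2.
Proof.
elim/ltn_ind: m h N => m IH h N dec h0.
case: N => [|N]; first by rewrite big_ord0.
rewrite sum_ord_recl.
case: (ltnP m 2) => hm.
  have hz j : h j.+1 = 0.
    by elim: j => [|j IHj]; [have := dec 0; lia | have := dec j.+1; lia].
  by rewrite big1 => [|i _]; [nia | exact: hz].
have h1 : h 1 <= m - 2 by have := dec 0; lia.
have := IH (m - 2) _ (fun j => h j.+1) N (fun j => dec j.+1) h1.
case: m h0 hm h1 {IH} => [|[|m]] // h0 _ h1; rewrite !subSS subn0 => /(_ (leqnSn _)).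
by move: h0; nia.
Qed.

Definition transmission (G : sgraph) (v : G) := \sum_(x : G) dist v x.
Definition far (G : sgraph) (v : G) j := #|[set x | j < dist v x]|.

Lemma far_layer (G : sgraph) (v : G) j : far v j = far v j.+1 + #|[set x | dist v x == j.+1]|.
Proof.
rewrite /far -cardsUI [X in _ + X]eq_card0 ?addn0 => [|x]; last by rewrite !inE; lia.
by apply: eq_card => x; rewrite !inE; lia.
Qed.

Section Layers.
Variable G : sgraph.
Hypothesis cG : connected G.
Implicit Types v x y z : G.

(** Double counting: x is counted in [far v j] exactly for the indices j below [dist v x], and these
    are all below [#|G|]. *)
Lemma transmission_far v : transmission v = \sum_(j < #|G|) far v j.
Proof.
rewrite /transmission /far.
under [RHS]eq_bigr do rewrite -sum1_card big_mkcond.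
rewrite exchange_big; apply: eq_bigr => x _ /=.
under [RHS]eq_bigr do rewrite inE.
have lt := dist_lt_card (conn cG v x).
by rewrite -big_mkcond -(big_ord_widen _ (fun=> 1) (ltnW lt)) sum1_card card_ord.
Qed.

Lemma far0 v : far v 0 = #|G|.-1.
Proof.
rewrite /far (_ : [set x | _] = ~: [set v]) ?cardsC1 //.
by apply/setP=> x; rewrite !inE lt0n dist_eq0E // eq_sym.
Qed.

Lemma exists_at_dist v x j : j <= dist v x ->
  exists2 z, dist v z = j & dist z x + j = dist v x.
Proof.
move=> le; have [m E] : exists m, dist v x = m + j by exists (dist v x - j); lia.
elim: m x E {le} => [|m IH] x; rewrite ?addSn => E; first by exists x; rewrite // distxx.
have [z azx dz] := dist_pred (conn cG v x) E.
have [w dw dwz] := IH z dz; exists w => //.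
have := dist_adj (conn cG w z) azx; have := dist_tri cG v w x; lia.
Qed.

Lemma layer_gt0 v j : 0 < far v j -> 0 < #|[set x | dist v x == j.+1]|.
Proof.
case/card_gt0P=> x; rewrite inE => /exists_at_dist[z dz _].
by apply/card_gt0P; exists z; rewrite inE dz.
Qed.

(** A shortest path to a vertex beyond distance j meets layer j + 1, so a nonzero value drops by at
    least one. *)
Lemma far_decr v j : far v j.+1 <= (far v j).-1.
Proof.
have := @layer_gt0 v j; rewrite (far_layer v j); lia.
Qed.

Lemma layer1_degree v : #|[set x | dist v x == 1]| = degree v.
Proof.
apply: eq_card => x; rewrite !inE; apply/eqP/idP => [d1|]; last exact: dist_adj1.
have [z azx /dist_eq0 ->] := dist_pred (conn cG v x) d1; rewrite ?conn //.
Qed.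

Lemma far1 v : far v 1 = #|G|.-1 - degree v.
Proof. by rewrite -(far0 v) (far_layer v 0) layer1_degree addnK. Qed.

Lemma dist_adj_le v x y : adj x y -> dist v y <= (dist v x).+1.
Proof. exact/dist_adj/conn. Qed.

Lemma degree_gt0 v : 1 < #|G| -> 0 < degree v.
Proof.
move=> gt1; rewrite -layer1_degree; apply: layer_gt0; rewrite far0; lia.
Qed.

End Layers.

(** * Deleting vertices *)

Section Induced.
Variables (G : sgraph) (A : {set G}).

Definition induced_adj : rel {x : G | x \in A} := fun x y => adj (val x) (val y).
Lemma induced_adj_sym : symmetric induced_adj.
Proof. by move=> x y; apply: adj_sym. Qed.
Lemma induced_adj_irrefl : irreflexive induced_adj.
Proof. by move=> x; apply: adj_irrefl. Qed.
Definition induced := SGraph induced_adj_sym induced_adj_irrefl.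

Lemma card_induced : #|induced| = #|A|.
Proof. by rewrite card_sig. Qed.

Lemma sum_induced (F : G -> nat) :
  \sum_(x : induced) F (val x) = \sum_(x in A) F x.
Proof.
by rewrite [RHS]big_sub.
Qed.

Lemma card_induced_set (P : pred G) :
  #|[set x : induced | P (val x)]| = #|[set x in A | P x]|.
Proof.
rewrite -!sum1_card; under eq_bigl do rewrite inE.
under [RHS]eq_bigl do rewrite inE.
rewrite big_mkcond (sum_induced (fun x => if P x then 1 else 0)).
by rewrite -big_mkcondr.
Qed.

Hypothesis cA : connected induced.

Lemma induced_dist (x y : induced) : dist (val x) (val y) <= dist x y.
Proof. by apply: (@weak_hom_dist_le induced) => // a b; right. Qed.

End Induced.

Notation del v := (induced [set~ v]).
Definition noncut (G : sgraph) (v : G) := connected (del v).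

Section Del.
Variable G : sgraph.
Hypothesis cG : connected G.
Implicit Types v x y z : G.

Lemma card_del v : #|del v| = #|G|.-1.
Proof. by rewrite card_induced cardsC1. Qed.

Lemma degree_del v (u : del v) : degree (val u) = degree u + adj (val u) v.
Proof.
rewrite /degree card_induced_set (cardsD1 v) inE addnC; congr (_ + _).
by apply: eq_card => y; rewrite !inE.
Qed.

(** The pairs containing [v] contribute its transmission; for the others, a walk in [del v] is a
    walk in [G], so distances do not grow on returning to [G]. *)
Lemma wiener_del v : noncut v -> wiener G <= transmission v + wiener (del v).
Proof.
move=> nv; rewrite -leq_double doubleD !wiener_double (bigD1 v) //= -/(transmission v).
rewrite -[X in _ <= X + _]addnn -addnA leq_add2l.
under eq_bigr => u _ do rewrite (bigD1 v) //=.
rewrite big_split /=; apply: leq_add.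
  by rewrite /transmission [X in _ <= X](bigD1 v) //= distxx; under eq_bigr do rewrite dist_sym.
under eq_bigl => u do rewrite -in_setC1.
rewrite -(sum_induced [set~ v] (fun u => \sum_(w | w != v) dist u w)).
apply: leq_sum => u _; under eq_bigl => w do rewrite -in_setC1.
rewrite -(sum_induced [set~ v] (fun w => dist (val u) w)).
by apply: leq_sum => w _; apply: induced_dist.
Qed.

(** Shortest walks from [r] to other vertices avoid [v]: a vertex preceding x on such a walk is
    strictly nearer to [r] than x, hence nearer than [v]. *)
Lemma farthest_noncut r v : v != r -> (forall x, dist r x <= dist r v) -> noncut v.
Proof.
move=> vr hv; have rv : r \in [set~ v] by rewrite !inE eq_sym.
apply: (@connected_root (del v) (exist (fun x => x \in [set~ v]) r rv)).
move=> [x xv]; move: (erefl (dist r x)); move: {2}(dist r x) => m.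
elim: m x xv => [|m IH] x xv E.
  have e := dist_eq0 (conn cG r x) E; move: xv; rewrite -e => xv.
  by rewrite (bool_irrelevance xv rv).
have [z azx dz] := dist_pred (conn cG r x) E.
have zv : z \in [set~ v].
  by rewrite !inE; apply/eqP => e; have := hv x; rewrite E -e dz; lia.
apply: connect_trans (IH z zv dz) _; exact: connect1.
Qed.

Lemma exists_noncut : 1 < #|G| -> exists v, noncut v.
Proof.
move=> gt1; have /card_gt0P[r _] : 0 < #|G| by lia.
have [v _ hv] := @arg_maxnP G r predT (fun x => dist r x) isT.
exists v; apply: (@farthest_noncut r) => [|x]; last exact: hv.
apply/eqP => e; have : far r 0 = 0.
  apply/eqP; rewrite cards_eq0; apply/eqP/setP => x; rewrite !inE.
  by have := hv x isT; rewrite /= e distxx; case: (dist r x).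
by rewrite far0 //; lia.
Qed.

Lemma degree1_uniq x y z : degree x = 1 -> adj x y -> adj x z -> y = z.
Proof.
move=> /eqP/cards1P[w /setP E] xy xz.
by have := E y; have := E z; rewrite !inE xy xz => /esym/eqP -> /esym/eqP ->.
Qed.

(** [insubd] with default [u], the only neighbour of [v], folds [v] onto [u] and fixes everything
    else; connectedness passes to the image. *)
Lemma pendant_noncut v : degree v = 1 -> noncut v.
Proof.
move=> d1; have /card_gt0P[u] : 0 < degree v by rewrite d1.
rewrite inE => vu.
have uv : u \in [set~ v] by rewrite !inE; apply: contraTneq vu => ->; rewrite adj_irrefl.
apply: (@weak_hom_connected G (del v) (fun x => insubd (exist _ u uv) x)) => //.
  move=> a b ab; case: (eqVneq a v) => [av|av].
    left; have -> : b = u by apply: (degree1_uniq d1) => //; rewrite -av.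
    by apply: val_inj; rewrite !val_insubd av !inE eqxx /=; case: ifP.
  case: (eqVneq b v) => [bv|bv].
    left; have -> : a = u by apply: (degree1_uniq d1) => //; rewrite -bv adj_sym.
    by apply: val_inj; rewrite !val_insubd bv !inE eqxx /=; case: ifP.
  by right; rewrite /= /induced_adj !val_insubd !inE av bv.
move=> [y yv]; exists y; apply: val_inj; by rewrite val_insubd yv.
Qed.

End Del.

(** * Bounds on the Wiener index *)

Lemma bin3S m : 'C(m.+1, 3) = 'C(m, 2) + 'C(m, 3).
Proof. by rewrite binS addnC. Qed.

Lemma pendant_free (G : sgraph) (w : G) :
  #|pendants G| = 0 -> degree w <> 1.
Proof. by move/cards0_eq/setP/(_ w); rewrite !inE => /eqP. Qed.

Section Bounds.
Variable G : sgraph.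
Hypothesis cG : connected G.
Implicit Types v x y z : G.

Lemma card_gt0G : 0 < #|G|.
Proof. by case/connectedP: cG. Qed.

Lemma transmission_le v : transmission v <= 'C(#|G|, 2) /\
  (transmission v = 'C(#|G|, 2) -> forall j, far v j = #|G|.-1 - j).
Proof.
rewrite transmission_far //.
have [] := @sum_decreasing #|G|.-1 (far v) #|G| (far_decr cG v).
  by rewrite far0.
by rewrite prednK ?card_gt0G.
Qed.

Lemma transmission_split v :
  transmission v = #|G|.-1 + \sum_(j < #|G|.-1) far v j.+1.
Proof.
rewrite transmission_far //; have := far0 cG v.
by case: #|G| card_gt0G => // m _ f0; rewrite sum_ord_recl f0.
Qed.

(** [far v 0] is [#|G|.-1] whatever the degree, and [far v 1] is at most [#|G|.-1 - r], from where
    [sum_decreasing] takes over. *)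
Lemma transmission_degree_le v r : r <= degree v ->
  transmission v <= #|G|.-1 + 'C(#|G| - r, 2).
Proof.
move=> hr; rewrite transmission_split leq_add2l.
have [|le _] := @sum_decreasing (#|G|.-1 - r) (fun j => far v j.+1) #|G|.-1
  (fun j => far_decr cG v j.+1); first by rewrite far1 // leq_sub2l.
apply: leq_trans le _; case: (leqP #|G| r) => h; last by rewrite leq_bin2l //; lia.
by have -> : (#|G|.-1 - r).+1 = 1 by lia.
Qed.

(** Layer j + 1 has [far v j - far v j.+1] vertices, here at most one. *)
Lemma layer_inj v j x y : far v j <= (far v j.+1).+1 ->
  dist v x = j.+1 -> dist v y = j.+1 -> x = y.
Proof.
rewrite (far_layer v j) -[(far v j.+1).+1]addn1 leq_add2l => /card_le1_eqP h dx dy.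
by apply: h; rewrite inE ?dx ?dy.
Qed.

Lemma degree_le1 x c : (forall u, adj x u -> u = c) -> degree x <= 1.
Proof.
by move=> h; apply/card_le1_eqP => a b; rewrite !inE => /h -> /h ->.
Qed.

(** With values 2, 1 and then 0, the two farthest layers are single vertices [c] and [w]; the
    neighbours of [w] lie in these layers, so [c] is the only one and [w] is a pendant. *)
Lemma far_no_fork v j : (forall w, w != v -> degree w <> 1) ->
  far v j = 2 -> far v j.+1 <> 1.
Proof.
move=> np f2 f1.
have f0 : far v j.+2 = 0 by have := far_decr cG v j.+1; lia.
have : far v j.+1 = 1 by [].
case/eqP/cards1P=> w /setP E.
have dw : dist v w = j.+2.
  have := E w; have /setP/(_ w) := cards0_eq f0; rewrite !inE eqxx; lia.
have [c acw dc] := dist_pred (conn cG v w) dw.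
have wv : w != v by apply/eqP => e; move: dw; rewrite e distxx.
apply: (np _ wv); apply/eqP; rewrite eqn_leq degree_gt0 ?andbT //; last first.
  have := far0 cG v; have := far_decr cG v; move=> d.
  have : far v j <= far v 0 by elim: (j) => // i IH; have := d i; lia.
  lia.
apply: (@degree_le1 w c) => u wu.
have : j.+1 <= dist v u.
  by have := @dist_adj_le G cG v u w; rewrite adj_sym => /(_ wu); lia.
rewrite leq_eqVlt => /orP[/eqP du|du]; first by apply: (@layer_inj v j) => //; rewrite ?f1 ?f2.
have := E u; rewrite !inE du => /esym/eqP e; by rewrite e adj_irrefl in wu.
Qed.

Lemma transmission_pendant_lt v : 2 < #|G| -> (forall w, w != v -> degree w <> 1) ->
  transmission v < 'C(#|G|, 2) /\
  ((transmission v).+1 = 'C(#|G|, 2) ->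
    forall j, far v j = if j <= #|G|.-1 - 2 then #|G|.-1 - j else 0).
Proof.
move=> n3 np; rewrite transmission_far //.
have [||] := @sum_decreasing_fork #|G|.-1 (far v) #|G| (far_decr cG v)
  (fun j => @far_no_fork v j np); [by lia | by rewrite far0 |].
by rewrite prednK ?card_gt0G.
Qed.

Lemma transmission_degree_lt v r : r <= degree v -> r + 2 < #|G| ->
  (forall w, w != v -> degree w <> 1) ->
  transmission v < #|G|.-1 + 'C(#|G| - r, 2) /\
  ((transmission v).+1 = #|G|.-1 + 'C(#|G| - r, 2) ->
    forall j, far v j.+1 = if j <= #|G|.-1 - r - 2 then #|G|.-1 - r - j else 0).
Proof.
move=> hr n3 np; rewrite transmission_split.
have [||] := @sum_decreasing_fork (#|G|.-1 - r) (fun j => far v j.+1) #|G|.-1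
  (fun j => far_decr cG v j.+1) (fun j => @far_no_fork v j.+1 np).
- by lia.
- by rewrite far1 // leq_sub2l.
have -> : (#|G|.-1 - r).+1 = #|G| - r by lia.
by move=> lt eq; split=> [|E]; [lia|apply: eq; lia].
Qed.

(* If the three farthest vertices from [v] form layers of sizes 1 and 2, then
   they span a triangle, for otherwise there would be a pendant. *)
Lemma last_layers_triangle v i : (forall w, w != v -> degree w <> 1) ->
  far v i = 3 -> far v i.+1 = 2 -> far v i.+2 = 0 ->
  exists z p q, [/\ dist v z = i.+1, dist v p = i.+2, dist v q = i.+2, p != q &
    [/\ adj z p, adj z q & adj p q]].
Proof.
move=> np f3 f2 f0.
have d0 x : dist v x <= i.+2.
  by have /setP/(_ x) := cards0_eq f0; rewrite !inE; lia.
move/eqP/cards2P: (f2) => [p [q [pq /setP E]]].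
have dp : dist v p = i.+2 by have := E p; have := d0 p; rewrite !inE eqxx; lia.
have dq : dist v q = i.+2 by have := E q; have := d0 q; rewrite !inE eqxx orbT; lia.
have n1 : 1 < #|G| by rewrite (cardD1 p) (cardD1 q) !inE eq_sym pq.
have nbr a b : dist v a = i.+2 -> (forall x, dist v x = i.+2 -> x = a \/ x = b) ->
    (exists2 z, dist v z = i.+1 & adj z a) /\ adj a b.
  move=> da h; have [z za dz] := dist_pred (conn cG v a) da; split; first by exists z.
  have av : a != v by apply/eqP => e; move: da; rewrite e distxx.
  apply/negPn/negP => nab; apply: (np a av).
  apply/eqP; rewrite eqn_leq degree_gt0 // andbT; apply: (@degree_le1 a z) => u au.
  have : i.+1 <= dist v u.
    by have := @dist_adj_le G cG v u a; rewrite adj_sym => /(_ au); lia.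
  rewrite leq_eqVlt => /orP[/eqP du|du].
    by apply: (@layer_inj v i) => //; rewrite ?f2 ?f3.
  have /h[] : dist v u = i.+2 by have := d0 u; lia.
    by move=> e; rewrite e adj_irrefl in au.
  by move=> e; rewrite e (negbTE nab) in au.
have [[z dz zp] apq] : (exists2 z, dist v z = i.+1 & adj z p) /\ adj p q.
  by apply: nbr => // x dx; have := E x; rewrite !inE dx ltnSn => /esym/orP[]/eqP; auto.
have [[z' dz' zq] _] : (exists2 z, dist v z = i.+1 & adj z q) /\ adj q p.
  by apply: nbr => // x dx; have := E x; rewrite !inE dx ltnSn => /esym/orP[]/eqP; auto.
have e : z' = z by apply: (@layer_inj v i) => //; rewrite ?f2 ?f3.
by exists z, p, q; rewrite e in zq; split=> //; split.
Qed.

End Bounds.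

Lemma wiener_le_path (G : sgraph) : connected G -> wiener G <= 'C(#|G|.+1, 3).
Proof.
move: {2}#|G| (erefl #|G|) => n; elim: n G => [|n IH] G E cG.
  by have := card_gt0G cG; rewrite E.
case: n IH E => [|n] IH E.
  rewrite -leq_double wiener_double big1 // => u _; rewrite big1 // => v _.
  have /card_le1_eqP h : #|G| <= 1 by rewrite E.
  by rewrite (h u v) ?distxx.
have [|v nv] := exists_noncut cG; first by rewrite E.
have := wiener_del nv; have [le _] := transmission_le cG v.
have Ed : #|del v| = n.+1 by rewrite card_del E.
have := IH _ Ed nv; rewrite Ed E (bin3S n.+2); rewrite E in le; lia.
Qed.

(** Equality would give [v] the transmission C(n, 2), hence single-vertex layers. The three corners
    would then have distinct distances from [v], yet any two of these differ by at most one. *)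
Lemma wiener_triangle_lt (G : sgraph) (a b c : G) : connected G ->
  adj a b -> adj b c -> adj a c -> wiener G < 'C(#|G|.+1, 3).
Proof.
move=> cG ab bc ac.
have ne (x y : G) : adj x y -> x != y.
  by move=> h; apply: contraTneq h => ->; rewrite adj_irrefl.
have gt1 : 1 < #|G| by rewrite (cardD1 a) (cardD1 b) !inE eq_sym ne.
have [v nv] := exists_noncut cG gt1.
have := wiener_del nv; have [le eq] := transmission_le cG v.
have := wiener_le_path nv; rewrite card_del prednK ?bin3S; last by lia.
suff : transmission v <> 'C(#|G|, 2) by lia.
move/eq => far_eq.
have inj x y : adj x y -> dist v x <> dist v y.
  move=> xy; case E : (dist v x) => [|j] /esym E'.
    have := ne _ _ xy; have /eqP := E; rewrite dist_eq0E // => /eqP <-.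
    by move/eqP: E'; rewrite dist_eq0E // => /eqP <-; rewrite eqxx.
  have := ne _ _ xy; suff -> : x = y by rewrite eqxx.
  by apply: (@layer_inj G v j) => //; rewrite !far_eq; lia.
have lip x y : adj x y -> dist v x <= (dist v y).+1 /\ dist v y <= (dist v x).+1.
  by move=> xy; split; apply: dist_adj_le; rewrite // adj_sym.
have := lip _ _ ab; have := lip _ _ bc; have := lip _ _ ac.
have := inj _ _ ab; have := inj _ _ bc; have := inj _ _ ac; lia.
Qed.

Section DelPendants.
Variable G : sgraph.
Implicit Types v x : G.

Lemma pendants_del v x (xv : x \in [set~ v]) : degree x <> 1 ->
  (exist _ x xv : del v) \in pendants (del v) -> adj x v /\ degree x = 2.
Proof.
rewrite inE => d1 /eqP; have := @degree_del G v (exist _ x xv); rewrite /= => ->.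
by move=> E; move: d1; rewrite (@degree_del G v (exist _ x xv)) /= E; case: (adj x v).
Qed.

(** Only a neighbour of the deleted vertex can become a pendant, and [v] has just one. *)
Lemma pendants_del_pendant v : degree v = 1 ->
  (forall w, w != v -> degree w <> 1) -> #|pendants (del v)| <= 1.
Proof.
move=> d1 np; apply/card_le1_eqP => -[x xv] [y yv] /= hx hy.
have [|ax _] := pendants_del _ hx; first by apply: np; move: (xv); rewrite !inE.
have [|ay _] := pendants_del _ hy; first by apply: np; move: (yv); rewrite !inE.
by apply: val_inj; apply: (degree1_uniq d1); rewrite adj_sym.
Qed.

Lemma pendant_unique v w : #|pendants G| <= 1 -> degree v = 1 -> w != v -> degree w <> 1.
Proof.
move=> /card_le1_eqP h /eqP dv wv /eqP dw.
by have := h v w; rewrite !inE => /(_ dv dw) e; rewrite e eqxx in wv.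
Qed.

End DelPendants.

(** Induction deleting the pendant: its transmission saves 1, and [del v] again has at most one
    pendant, saving [#|G| - 3]. Without pendants, a non-cut vertex has degree at least two, which
    saves [#|G| - 2] at once. *)
Lemma wiener_one_pendant (G : sgraph) : connected G -> 2 < #|G| ->
  #|pendants G| <= 1 -> wiener G + (#|G| - 2) <= 'C(#|G|.+1, 3).
Proof.
move: {2}#|G| (erefl #|G|) => n; elim: n G => [|n IH] G E cG n2 p1.
  by rewrite E in n2.
case: (posnP #|pendants G|) => [p0|].
  have [|v nv] := exists_noncut cG; first by lia.
  have hd : 2 <= degree v.
    have := @degree_gt0 G cG v; have := @pendant_free G v p0; lia.
  have := wiener_del nv; have := wiener_le_path nv.
  have := transmission_degree_le cG hd; rewrite card_del.
  case: n {IH} E => [|[|n]] E; [by lia|by lia|].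
  by rewrite E -[n.+3.-1]/(n.+2) !subSS subn0 (bin3S n.+3) !bin2S; lia.
case/card_gt0P=> v pv; have d1 : degree v = 1 by move: pv; rewrite inE => /eqP.
have nv := pendant_noncut cG d1.
have np w : w != v -> degree w <> 1 by apply: pendant_unique.
have [lt _] := transmission_pendant_lt cG n2 np.
have := wiener_del nv; have := wiener_le_path nv; rewrite card_del.
(* On three vertices [del v] is too small for the induction hypothesis; the path bound ['C(3, 3)]
   suffices. *)
case: (ltnP 3 #|G|) => n3; last first.
  have E3 : #|G| = 3 by lia.
  rewrite E3 /= in lt *; rewrite (_ : 'C(4, 3) = 4) // (_ : 'C(3, 3) = 1) //.
  by rewrite (_ : 'C(3, 2) = 3) // in lt; lia.
move=> _ le.
have Ed : #|del v| = n by rewrite card_del E.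
have := IH _ Ed nv; rewrite Ed.
have -> : n = #|G|.-1 by rewrite E.
rewrite prednK; last by lia.
rewrite bin3S => /(_ _ _) h; suff : wiener (del v) + (#|G|.-1 - 2) <= 'C(#|G|, 3) by lia.
apply: h; first by lia.
exact: pendants_del_pendant.
Qed.

(** Degree at least two saves [#|G| - 2], and the forbidden ending 2, 1, 0 saves one more. Equality
    makes the layer sequence extremal, and its value [far v 1] gives degree exactly two. *)
Lemma transmission_no_pendant (G : sgraph) (v : G) : connected G ->
  #|pendants G| = 0 -> 4 < #|G| -> transmission v + #|G|.-1 <= 'C(#|G|, 2) /\
  (transmission v + #|G|.-1 = 'C(#|G|, 2) ->
   degree v = 2 /\ forall j, far v j.+1 = if j <= #|G| - 5 then #|G| - 3 - j else 0).
Proof.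
move=> cG p0 n4.
have hd : 2 <= degree v.
  have := @degree_gt0 G cG v; have := @pendant_free G v p0; lia.
have [||lt eq] := @transmission_degree_lt G cG v 2 hd; first by lia.
  by move=> w _; apply: pendant_free.
case: #|G| n4 (far1 cG v) lt eq => [|[|[|[|[|n]]]]] //= _ f1.
rewrite !subSS !subn0 !bin2S => lt eq; split=> [|E]; first by lia.
have {}eq := eq ltac:(lia); split; last exact: eq.
by have := eq 0; rewrite f1 /=; lia.
Qed.

Lemma wiener_no_pendant (G : sgraph) : connected G -> #|pendants G| = 0 ->
  4 < #|G| -> wiener G + #|G|.-1 <= 'C(#|G|.+1, 3).
Proof.
move=> cG p0 n4; have [|v nv] := exists_noncut cG; first by lia.
have := wiener_del nv; have := wiener_le_path nv.
have [le _] := @transmission_no_pendant G v cG p0 n4.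
by rewrite card_del prednK ?bin3S; lia.
Qed.

(** * Recognizing lollipops and dumbbells *)

Lemma iso_of_labelling (G : sgraph) n (r : rel nat) (f : G -> nat) :
  #|G| = n -> (forall x, f x < n) -> injective f ->
  (forall x y, adj x y = (f x != f y) && (r (f x) (f y) || r (f y) (f x))) ->
  isomorphic G (graph_of_arcs (fun i j : 'I_n => r i j)).
Proof.
move=> cn fn injf hadj; exists (fun x => Ordinal (fn x) : graph_of_arcs _).
  by apply: inj_card_bij => [x y [/injf]|]; rewrite ?card_ord ?cn.
by move=> x y; rewrite hadj.
Qed.

Section PathLayers.
Variables (G : sgraph) (v : G) (Q : pred G).
Hypothesis cG : connected G.
Hypothesis inj_dist : forall x y, ~~ Q x -> ~~ Q y -> dist v x = dist v y -> x = y.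
Hypothesis pred_notin : forall y, ~~ Q y -> forall z, adj z y ->
  (dist v z).+1 = dist v y -> ~~ Q z.

(** Off [Q], the distance from [v] identifies a vertex, so the neighbour one step nearer on a
    shortest path must be the vertex in question. [Q] holds the exceptional vertices: one for the
    lollipop, two for the dumbbell, none for a path. *)
Lemma path_layers_adj x y : ~~ Q x -> ~~ Q y ->
  adj x y = ((dist v x).+1 == dist v y) || ((dist v y).+1 == dist v x).
Proof.
have up a b : ~~ Q a -> ~~ Q b -> (dist v a).+1 = dist v b -> adj a b.
  move=> Qa Qb /esym E; have [z zb dz] := dist_pred (conn cG v b) E.
  suff -> : a = z by [].
  by apply: inj_dist => //; apply: pred_notin zb _; rewrite // dz.
move=> Qx Qy; apply/idP/orP => [xy|[]/eqP/up]; last 2 first.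
- exact.
- by rewrite adj_sym; apply.
have := dist_adj_le cG v xy.
have yx : adj y x by rewrite adj_sym.
have := dist_adj_le cG v yx.
case: (ltngtP (dist v x) (dist v y)) => [lt _ le|lt le _|/inj_dist e].
- by left; rewrite eqn_leq lt le.
- by right; rewrite eqn_leq lt le.
by rewrite e // adj_irrefl in xy.
Qed.

End PathLayers.

(** The layers are single vertices except the last, [p] and [q], which forms a triangle with the
    vertex [z] before it. Away from [q] the graph is a path. *)
Lemma iso_lollipop (G : sgraph) (v : G) : connected G -> 3 < #|G| ->
  (forall w, w != v -> degree w <> 1) ->
  (forall j, far v j = if j <= #|G|.-1 - 2 then #|G|.-1 - j else 0) ->
  isomorphic G (lollipop #|G| 3).
Proof.
move=> cG; case E: #|G| => [|[|[|[|n]]]] // _ np /=; rewrite !subSS subn0 => hf.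
have [|||z [p [q [dz dp dq pq [zp zq apq]]]]] := @last_layers_triangle G cG v n np.
- by rewrite hf; case: ifP; lia.
- by rewrite hf; case: ifP; lia.
- by rewrite hf; case: ifP; lia.
have dle x : dist v x <= n.+2.
  have /cards0_eq/setP/(_ x) : far v n.+2 = 0 by rewrite hf; case: ifP; lia.
  by rewrite !inE; lia.
have layer j x y : j <= n -> dist v x = j.+1 -> dist v y = j.+1 -> x = y.
  move=> jn; apply: layer_inj => //; rewrite !hf; case: ifP; case: ifP; lia.
have last x : dist v x = n.+2 -> x != q -> x = p.
  move=> dx xq; have : far v n.+1 = 2 by rewrite hf; case: ifP; lia.
  rewrite /far (cardsD1 p) (cardsD1 q) !inE dp dq ltnSn eq_sym pq /=.
  case=> /cards0_eq/setP/(_ x); rewrite !inE dx ltnSn xq andbT.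
  by move/negbT; rewrite negbK => /eqP.
have inj_d x y : x != q -> y != q -> dist v x = dist v y -> x = y.
  move=> xq yq dxy; case: (leqP (dist v x) n.+1) => h.
    case dx : (dist v x) h => [|j] h; last by apply: (@layer j) => //; rewrite -dxy.
    have /eqP := dx; rewrite dist_eq0E // => /eqP <-.
    by have /eqP := dxy; rewrite dx eq_sym dist_eq0E // => /eqP.
  have dx : dist v x = n.+2 by apply/eqP; rewrite eqn_leq dle h.
  by rewrite (last x dx xq) (last y) // -dxy.
have adjE := @path_layers_adj G v (pred1 q) cG inj_d.
have {}adjE x y : x != q -> y != q ->
    adj x y = ((dist v x).+1 == dist v y) || ((dist v y).+1 == dist v x).
  apply: adjE => /= {}y _ w _ dw; apply/eqP => e.
  by have := dle y; rewrite -dw e dq; lia.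
have adjq y : y != q -> adj q y = (n < dist v y).
  move=> yq; apply/idP/idP => [qy|lt].
    by have := @dist_adj_le G cG v y q; rewrite adj_sym dq => /(_ qy); lia.
  case: (ltnP n.+1 (dist v y)) => h.
    by rewrite (last y) // 1?adj_sym //; have := dle y; lia.
  by rewrite (@layer n y z) // 1?adj_sym //; lia.
rewrite /lollipop.
(* Labels run backwards towards [v]: [q] gets 0, [p] gets 1 and [z] gets 2, the triangle at the
   start of [lollipop]. *)
apply: (@iso_of_labelling G n.+4 (fun i j => (i.+1 == j) || (i == 0) && (j.+1 == 3))
  (fun x => if x == q then 0 else n.+3 - dist v x)) => // [x|x y|x y].
- by case: ifP; lia.
- case: (eqVneq x q) => [->|xq]; case: (eqVneq y q) => [->|yq] //.
  + by have := dle y; lia.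
  + by have := dle x; lia.
  by have := dle x; have := dle y; move=> *; apply: inj_d => //; lia.
- case: (eqVneq x q) => [->|xq]; case: (eqVneq y q) => [->|yq].
  + by rewrite adj_irrefl.
  + by rewrite adjq //; have := dle y; lia.
  + by rewrite adj_sym adjq //; have := dle x; lia.
  by rewrite adjE //; have := dle x; have := dle y; lia.
Qed.

Lemma degree2_neighbours (G : sgraph) (v x y u : G) : degree v = 2 ->
  adj v x -> adj v y -> x != y -> adj v u -> u = x \/ u = y.
Proof.
move=> d2 vx vy xy vu; case: (eqVneq u x) => [|ux]; first by left.
case: (eqVneq u y) => [|uy]; first by right.
move: d2; rewrite /degree (cardsD1 x) (cardsD1 y) (cardsD1 u) !inE.
by rewrite vx vy vu (eq_sym y) xy ux uy.
Qed.

(** Both ends carry a triangle: [v], [x], [y] by assumption, and [z], [p], [q] in the last two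
    layers. With [x] and [q] set aside, the distance from [v] identifies every vertex. *)
Lemma iso_dumbbell (G : sgraph) (v x y : G) : connected G -> 6 < #|G| ->
  (forall w, w != v -> degree w <> 1) -> degree v = 2 -> degree x = 2 ->
  adj v x -> adj v y -> adj x y ->
  (forall j, far v j.+1 = if j <= #|G| - 5 then #|G| - 3 - j else 0) ->
  isomorphic G (dumbbell 3 3 #|G|).
Proof.
move=> cG; case E: #|G| => [|[|[|[|[|[|[|n]]]]]]] // _ np dv dx vx vy xy.
rewrite !subSS !subn0 => hf.
have f3 : far v n.+2 = 3 by rewrite hf; case: ifP; lia.
have f2 : far v n.+3 = 2 by rewrite hf; case: ifP; lia.
have f0 : far v n.+4 = 0 by rewrite hf; case: ifP; lia.
have fS j : j <= n.+1 -> far v j.+1 <= (far v j.+2).+1.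
  by rewrite !hf; case: ifP; case: ifP; lia.
have [z [p [q [dz dp dq pq [zp zq apq]]]]] := last_layers_triangle cG np f3 f2 f0.
have dle u : dist v u <= n.+4.
  by have /setP/(_ u) := cards0_eq f0; rewrite !inE; clear; lia.
have xny : x != y by apply: contraTneq xy => ->; rewrite adj_irrefl.
have nbv := degree2_neighbours dv vx vy xny.
have vny : v != y by apply: contraTneq vy => ->; rewrite adj_irrefl.
have nbx : forall u, adj x u -> u = v \/ u = y.
  by move=> u; apply: degree2_neighbours; rewrite // adj_sym.
have [dvx dvy] := (dist_adj1 vx, dist_adj1 vy).
have layer1 u : dist v u = 1 -> u = x \/ u = y.
  move=> /(dist_pred (conn cG v u))[w wu dw]; apply: nbv.
  by rewrite (dist_eq0 (conn cG v w) dw).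
have layer j u w : j <= n.+1 -> dist v u = j.+2 -> dist v w = j.+2 -> u = w.
  by move=> /fS; apply: layer_inj.
have last u : dist v u = n.+4 -> u != q -> u = p.
  move=> du uq; move: f2; rewrite /far (cardsD1 p) (cardsD1 q) !inE dp dq ltnSn eq_sym pq /=.
  case=> /cards0_eq/setP/(_ u); rewrite !inE du ltnSn uq andbT.
  by move/negbT; rewrite negbK => /eqP.
pose Q := pred2 x q.
have inj_d a b : ~~ Q a -> ~~ Q b -> dist v a = dist v b -> a = b.
  rewrite /= !negb_or => /andP[ax aq] /andP[bx bq] dab.
  case: (leqP (dist v a) n.+3) => h.
    case da : (dist v a) h => [|[|j]] h; last by apply: (@layer j) => //; rewrite -dab.
      have /eqP := da; rewrite dist_eq0E // => /eqP <-.
      by have /eqP := dab; rewrite da eq_sym dist_eq0E // => /eqP.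
    have [e|->] := layer1 a da; first by rewrite e eqxx in ax.
    have [e|->] // := layer1 b (etrans (esym dab) da); by rewrite e eqxx in bx.
  have da : dist v a = n.+4 by apply/eqP; rewrite eqn_leq dle h.
  by rewrite (last a da aq) (last b) // -dab.
have adjE a b : ~~ Q a -> ~~ Q b ->
    adj a b = ((dist v a).+1 == dist v b) || ((dist v b).+1 == dist v a).
  apply: path_layers_adj => // {}b Qb w wb dw /=; rewrite negb_or.
  apply/andP; split; apply/eqP => e; last by have := dle b; rewrite -dw e dq ltnn.
  (* If the predecessor of [b] were [x], then [b] would be at distance two from [v], yet the only
     neighbours of [x] are [v] and [y]. *)
  rewrite e dvx in dw; have [e'|e'] := nbx b ltac:(by rewrite -e).
    by move: dw; rewrite e' distxx.
  by move: dw; rewrite e' dvy.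
have adjq u : u != q -> adj q u = (n.+2 < dist v u).
  move=> uq; apply/idP/idP => [qu|lt].
    by have := @dist_adj_le G cG v u q; rewrite adj_sym dq => /(_ qu).
  have := dle u; rewrite leq_eqVlt => /orP[/eqP du|lt']; first by rewrite (last u) // adj_sym.
  by rewrite (@layer n.+1 u z) // 1?adj_sym //; apply/eqP; rewrite eqn_leq lt -ltnS lt'.
have adjx u : u != x -> adj x u = (dist v u <= 1).
  move=> ux; apply/idP/idP => [/nbx[]->|]; rewrite ?distxx ?dvy //.
  case du : (dist v u) => [|[|//]] _.
    by rewrite -(dist_eq0 (conn cG v u) du) adj_sym.
  by have [e|->] := layer1 u du; first by rewrite e eqxx in ux.
have qx : q != x by apply/eqP => e; move: dq; rewrite e dvx.
rewrite /dumbbell.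
(* [x] gets 0 and [q] the last label; the shift by one puts [v] at 1 and [y] at 2, completing the
   first triangle. *)
apply: (@iso_of_labelling G n.+4.+3 (fun i j => [|| i.+1 == j, (i == 0) && (j.+1 == 3)
    | (i + 3 == n.+4.+3) && (j.+1 == n.+4.+3)])
  (fun u => if u == x then 0 else if u == q then n.+4.+2 else (dist v u).+1)) =>
  // [u|a b|a b].
- by have := dle u; clear; case: ifP => // _; case: ifP; lia.
- case: (eqVneq a x) => [->|ax]; case: (eqVneq b x) => [->|bx] //.
  + by case: ifP.
  + by case: ifP.
  have := dle a; have := dle b.
  case: (eqVneq a q) => [->|aq]; case: (eqVneq b q) => [->|bq] // lb la.
  + by move=> e; exfalso; move: e lb; clear; lia.
  + by move=> e; exfalso; move: e la; clear; lia.
  by case=> dab; apply: inj_d; rewrite //= negb_or ?ax ?bx.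
- have := dle a; have := dle b.
  case: (eqVneq a x) => [->|ax]; case: (eqVneq b x) => [->|bx] lb la.
  + by rewrite adj_irrefl.
  + rewrite adjx //; case: (eqVneq b q) => [->|bq]; first by rewrite dq; clear; lia.
    by move: lb; clear; lia.
  + rewrite adj_sym adjx //; case: (eqVneq a q) => [->|aq]; first by rewrite dq; clear; lia.
    by move: la; clear; lia.
  case: (eqVneq a q) => [->|aq]; case: (eqVneq b q) => [->|bq].
  + by rewrite adj_irrefl eqxx.
  + by rewrite adjq //; move: lb; clear; lia.
  + by rewrite adj_sym adjq //; move: la; clear; lia.
  by rewrite adjE /Q /= ?negb_or ?ax ?bx //; move: la lb; clear; lia.
Qed.

(** * Graphs with at most one pendant *)

Lemma hom_walk (G H : sgraph) (f : G -> H) l x y :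
  (forall a b, adj a b -> adj (f a) (f b)) ->
  walk_of_length l x y -> walk_of_length l (f x) (f y).
Proof.
move=> hf /walkP[p [pp <- <-]]; apply/walkP; exists (map f p).
rewrite last_map size_map; split=> //; rewrite path_map.
by apply: sub_path pp => a b; apply: hf.
Qed.

Lemma isomorphic_wiener (G H : sgraph) : isomorphic G H -> wiener G = wiener H.
Proof.
case=> f bf hf; case: (bf) => g fK gK.
have df x y : dist (f x) (f y) = dist x y.
  rewrite /dist (bij_eq_card bf); apply: eq_find => l; apply/idP/idP => w.
    rewrite -[x]fK -[y]fK; apply: hom_walk w => a b.
    by rewrite -{1}[a]gK -{1}[b]gK hf.
  by apply: hom_walk w => a b; rewrite hf.
apply: double_inj; rewrite !wiener_double [RHS](reindex f) /=; last exact: onW_bij.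
apply: eq_bigr => u _; rewrite [RHS](reindex f) /=; last exact: onW_bij.
by apply: eq_bigr => w _.
Qed.

(** The Lipschitz condition gives [h x y <= dist x y]; descending along [h] from [y] builds a walk
    of length [h x y] for the converse. *)
Lemma dist_of_potential (G : sgraph) (h : G -> G -> nat) :
  (forall x y z, adj y z -> h x z <= (h x y).+1) -> (forall x, h x x = 0) ->
  (forall x y, h x y = 0 -> x = y) ->
  (forall x y m, h x y = m.+1 -> exists2 z, adj z y & h x z = m) ->
  forall x y, dist x y = h x y.
Proof.
move=> lip h0 h0E desc x y.
have [p [pp lp sp]] : exists p, [/\ path (@adj G) x p, last x p = y & size p = h x y].
  move E : (h x y) => m; elim: m y E => [|m IH] y E.
    by exists [::]; split=> //; apply: h0E.
  have [z zy /IH[p [pp lp sp]]] := desc x y m E.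
  by exists (rcons p y); rewrite rcons_path pp lp last_rcons size_rcons sp.
apply/eqP; rewrite eqn_leq -{1}sp -{1}lp dist_le_walk //=.
have := @lipschitz_dist G (h x) x y (lip x); rewrite h0 add0n; apply.
by apply/connectP; exists p.
Qed.

Lemma max_wiener_one_pendant (G : sgraph) n : graph_class n 1 G -> 3 < n ->
  wiener G + (n - 2) <= 'C(n.+1, 3) /\
  (wiener G + (n - 2) = 'C(n.+1, 3) -> isomorphic G (lollipop n 3)).
Proof.
case=> cG <- /eqP p1 n3; split; first by apply: wiener_one_pendant; lia.
have /cards1P[v /setP pv] := p1; have := pv v; rewrite !inE eqxx => /eqP d1.
have np w : w != v -> degree w <> 1 by apply: pendant_unique; rewrite // (eqP p1).
have nv := pendant_noncut cG d1.
have [lt eq] := transmission_pendant_lt cG (ltnW n3) np.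
have := @wiener_one_pendant (del v) nv; have := wiener_del nv.
rewrite card_del prednK ?bin3S; last by lia.
move=> le1 le2 E; apply: (@iso_lollipop G v) => //; apply: eq.
have := le2 ltac:(lia) (pendants_del_pendant d1 np); lia.
Qed.

Lemma wiener_no_cut_two_regular (G : sgraph) : connected G ->
  (forall v : G, noncut v /\ degree v = 2) -> 6 < #|G| ->
  wiener G + 2 * (#|G| - 2) < 'C(#|G|.+1, 3).
Proof.
move=> cG reg n6.
have dec (v : G) j : far v j.+1 <= far v j - 2.
  case: (posnP (far v j.+1)) => [->//|gt0].
  have gt0' : 0 < far v j by have := far_decr cG v j; lia.
  have := layer_gt0 cG gt0'; rewrite (far_layer v j).
  case E : #|_| => [|[|k]] // _; last by clear; lia.
  (* A layer consisting of [c] alone would cut: without [c], no edge leaves the ball of radius j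
     around [v], yet [w] lies beyond it. *)
  have /cards1P[c /setP Ec] : #|[set x | dist v x == j.+1]| == 1 by rewrite E.
  have [nc _] := reg c.
  have /eqP dc : dist v c == j.+1 by have := Ec c; rewrite !inE eqxx.
  have vc : v \in [set~ c] by rewrite !inE; apply/eqP => e; rewrite e distxx in dc.
  have [w] := card_gt0P gt0; rewrite inE => dw.
  have wc : w \in [set~ c] by rewrite !inE; apply/eqP => e; move: dw; rewrite e dc ltnn.
  have := @connect_ind (del c) nc (fun x => dist v (val x) <= j)
     (exist _ v vc) (exist _ w wc).
  rewrite /= distxx => h; suff : dist v w <= j by lia.
  apply: h => // -[a ac] [b bc] /= ab da.
  have := @dist_adj_le G cG v a b ab; have := Ec b; have := bc; rewrite !inE => /negbTE ->.
  by move/negbT; move: da; clear; lia.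
have le (v : G) : 4 * transmission v <= #|G| ^ 2.
  rewrite transmission_far //.
  have := @sum_decreasing_by_two #|G|.-1 (far v) #|G| (dec v).
  by rewrite far0 // prednK; [apply | lia].
have : 4 * (wiener G).*2 <= #|G| ^ 3.
  rewrite wiener_double big_distrr /= expnS -sum_nat_const.
  by apply: leq_sum => v _; apply: le.
have E : 'C(#|G|.+1, 3) * 6 = #|G|.+1 * #|G| * #|G|.-1.
  by have := bin_ffact #|G|.+1 3; rewrite !ffactnS ffactn0 muln1 !mulnA; apply.
(* From seven vertices on, n^3 / 8 + 2(n - 2) is below (n^3 - n) / 6; at six the two are equal. *)
move: E n6; set c := 'C(_, _); case: #|G| => [|[|[|[|[|[|[|m]]]]]]] // E _.
by rewrite /= in E; move: E; rewrite !expnS expn0; nia.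
Qed.

Lemma max_wiener_no_pendant (G : sgraph) n : graph_class n 0 G -> 6 < n ->
  wiener G + 2 * (n - 2) <= 'C(n.+1, 3) /\
  (wiener G + 2 * (n - 2) = 'C(n.+1, 3) -> isomorphic G (dumbbell 3 3 n)).
Proof.
case=> cG <- p0 n6.
have np (w : G) : degree w <> 1 by apply: pendant_free.
have dgt1 (w : G) : 1 < degree w by have := np w; have := @degree_gt0 G cG w; lia.
case: (boolP [exists v : G, noncut v && (2 < degree v)]) => [|].
  case/existsP=> v /andP[nv d3].
  suff : wiener G + 2 * (#|G| - 2) < 'C(#|G|.+1, 3) by lia.
  have [||lt eq] := @transmission_degree_lt G cG v 3 d3; [by lia | by move=> w _ |].
  have := wiener_le_path nv; have := wiener_del nv; rewrite card_del prednK; last by lia.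
  move: (transmission v) (wiener G) lt eq => T W lt eq le1 le2.
  (* Degree three saves 2n - 5 in the transmission and the forbidden ending one more, exactly 2(n -
     2) together. *)
  have bins : #|G|.-1 + 'C(#|G| - 3, 2) + 2 * (#|G| - 2) = ('C(#|G|, 2)).+1.
    by case: #|G| n6 => [|[|[|[|m]]]] // _; rewrite !subSS subn0 !bin2S; lia.
  rewrite bin3S; case: (ltngtP T.+1 (#|G|.-1 + 'C(#|G| - 3, 2))) => [|| /eq hf]; try lia.
  (* When the transmission bound is attained, the farthest triangle survives in [del v] and makes
     its path bound strict. *)
  suff : wiener (del v) < 'C(#|G|, 3).
    by have : T < #|G|.-1 + 'C(#|G| - 3, 2) := lt; lia.
  (* The values [#|G| - 4 - j] of [far v j.+1] reach 3 at index [#|G| - 6], followed by 2 and 0. *)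
  have := @last_layers_triangle G cG v (#|G| - 6).
  have -> : #|G| - 6 = (#|G| - 7).+1 by lia.
  rewrite !hf => h.
  have [||||z [p [q [dz dp dq pq [zp zq apq]]]]] := h.
  - by move=> w _.
  - by case: ifP; lia.
  - by case: ifP; lia.
  - by case: ifP; lia.
  have nin u m : dist v u = m.+1 -> u \in [set~ v].
    by move=> du; rewrite !inE; apply/eqP => e; rewrite e distxx in du.
  have := @wiener_triangle_lt (del v) (exist _ z (nin _ _ dz)) (exist _ p (nin _ _ dp))
    (exist _ q (nin _ _ dq)) nv zp apq zq.
  by rewrite card_del prednK //; lia.
rewrite negb_exists => /forallP hA.
have deg2 (v : G) : noncut v -> degree v = 2.
  move=> nv; have := hA v; have := dgt1 v; rewrite nv /= -leqNgt => *.
  by apply/eqP; rewrite eqn_leq; apply/andP.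
case: (boolP [exists v : G, noncut v && (#|pendants (del v)| <= 1)]).
  case/existsP=> v /andP[nv p1].
  (* The transmission saves n - 1 and [del v] saves n - 3, again 2(n - 2) together. *)
  have [le1 eq] := @transmission_no_pendant G v cG p0 ltac:(lia).
  have cd : #|del v|.+1 = #|G| by rewrite card_del prednK //; lia.
  have := wiener_one_pendant nv ltac:(lia) p1; have := wiener_del nv.
  have := @wiener_no_pendant (del v) nv.
  rewrite cd bin3S => le4 le2 le3; split; first by lia.
  move=> E; have [dv hf] := eq ltac:(lia).
  (* With no pendant at all, [del v] would save n - 2, one too many for equality. *)
  have {}p1 : #|pendants (del v)| == 1.
    rewrite eqn_leq p1 lt0n; apply/eqP => pd; have := le4 pd; lia.
  have /cards1P[[x xv] /setP Ex] := p1.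
  have := Ex (exist _ x xv); rewrite in_set1 eqxx => /(pendants_del (np x))[xadj dx].
  have vx : adj v x by rewrite adj_sym.
  have [y vy xy] : exists2 y, adj v y & x != y.
    have : 1 < degree v by rewrite dv.
    rewrite /degree (cardsD1 x) inE vx => /card_gt0P[y].
    by rewrite !inE eq_sym => /andP[xy vy]; exists y.
  have nbv u : adj v u -> u = x \/ u = y := degree2_neighbours dv vx vy xy (u:=u).
  have yv : y \in [set~ v].
    by rewrite !inE; apply: contraTneq vy => ->; rewrite adj_irrefl.
  have dy : 2 < degree y.
    have := Ex (exist _ y yv); rewrite in_set1 /pendants inE.
    have -> : (exist _ y yv == exist _ x xv :> del v) = false.
      by apply/eqP => -[e]; rewrite e eqxx in xy.
    have := @degree_del G v (exist _ y yv); rewrite /= (adj_sym y) vy.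
    have := dgt1 y; move: (degree y) => d; case: (degree _) => [|[|m]] //; clear; lia.
  have [c hc] : exists c, forall u, dist v u = 2 -> u = c.
    have : #|[set u | dist v u == 2]| = 1.
      have : far v 1 = far v 2 + #|[set u | dist v u == 2]| by apply: far_layer.
      by rewrite (hf 0) (hf 1) leq0n ifT; move: n6; clear; lia.
    by move/eqP/cards1P=> [c /setP Ec]; exists c => u du; apply/set1P; rewrite -Ec inE du.
  (* Otherwise the neighbours of [y] lie among [v] and the only vertex [c] at distance two, against
     [dy]. *)
  have xay : adj x y.
    apply/negPn/negP => nxy; move: dy; rewrite ltnNge => /negP[].
    apply: (@leq_trans #|[set v; c]|); last by rewrite cards2; case: (v != c).
    apply/subset_leq_card/subsetP => u; rewrite !inE => yu.
    have := dist_adj_le cG v yu; rewrite (dist_adj1 vy).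
    case du : (dist v u) => [|[|[|//]]] _.
    + by rewrite -(dist_eq0 (conn cG v u) du) eqxx.
    + have [w wu /(dist_eq0 (conn cG v w)) ew] := dist_pred (conn cG v u) du.
      have [e|e] := nbv u ltac:(by rewrite ew); move: yu; rewrite e.
        by rewrite adj_sym (negbTE nxy).
      by rewrite adj_irrefl.
    by rewrite (hc u du) eqxx orbT.
  by apply: (@iso_dumbbell G v x y).
rewrite negb_exists => /forallP hB.
suff reg : forall v : G, noncut v.
  have := @wiener_no_cut_two_regular G cG; suff : forall v : G, noncut v /\ degree v = 2.
    by move=> h /(_ h n6); lia.
  by move=> v; split; [|apply: deg2].
move=> u; have [|v nv] := exists_noncut cG; first by lia.
(* Being non-cut passes from [v] to its neighbour [x]: two pendants of [del v] are the two
   neighbours of [v], so [x] is one of them. *)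
apply: (@connect_ind G cG (@noncut G) v u) => [{u v nv} v x vx nv|//].
have := hB v; rewrite nv /= -ltnNge => /card_gt1P[[a av] [[b bv] [ha hb ab]]].
have [aadj _] := pendants_del (np a) ha; have [badj _] := pendants_del (np b) hb.
have {}ab : a != b by apply: contraNneq ab => e; apply/eqP/val_inj.
wlog ax : a b av bv ha hb aadj badj ab / x = a.
  move=> hw; rewrite adj_sym in aadj; rewrite adj_sym in badj.
  have [e|e] := degree2_neighbours (deg2 v nv) aadj badj ab vx.
    by apply: (hw a b); rewrite // adj_sym.
  by apply: (hw b a); rewrite // 1?adj_sym // eq_sym.
(* Contracting the pendant [x] of [G - v] onto its only neighbour [w] shows that
   [G - v - x] is connected; [v] is joined to it through [b]. *)
move: ha; rewrite -{}ax in av aadj ab *; rewrite inE => /eqP dx.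
have /eqP/cards1P[w /setP Ew] := dx.
have xw : adj x (val w) by have := Ew w; rewrite !inE eqxx.
have wx : val w \in [set~ x].
  by rewrite !inE; apply: contraTneq xw => ->; rewrite adj_irrefl.
pose f (u : del v) : del x := insubd (exist _ (val w) wx : del x) (val u).
have hf u u' : adj u u' -> f u = f u' \/ adj (f u) (f u').
  have key (s t : del v) : val s = x -> adj s t -> f s = f t.
    move=> sx st; have -> : t = w.
      by apply/set1P; rewrite -Ew inE /= /induced_adj /= -sx; exact: st.
    by apply: val_inj; rewrite !val_insubd sx !inE eqxx /=; case: ifP.
  move=> uu'; case: (eqVneq (val u) x) => [ux|ux]; first by left; apply: key.
  case: (eqVneq (val u') x) => [ux'|ux']; first by left; apply/esym/key; rewrite // adj_sym.
  by right; rewrite /= /induced_adj !val_insubd !inE ux ux'.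
have bx : b \in [set~ x] by rewrite !inE eq_sym.
have fb : f (exist _ b bv) = exist _ b bx.
  by apply: val_inj; rewrite val_insubd /= bx.
apply: (@connected_root (del x) (exist _ b bx)) => -[u ux].
case: (eqVneq u v) => [uv|uv]; first by apply: connect1; rewrite /= /induced_adj /= uv.
have uv' : u \in [set~ v] by rewrite !inE.
rewrite -fb; have -> : exist _ u ux = f (exist _ u uv').
  by apply: val_inj; rewrite val_insubd /= ux.
by have [] := weak_hom_dist hf (conn nv (exist _ b bv) (exist _ u uv')).
Qed.

(** * Graphs with at least two pendants *)

Lemma sum_separated (I : finType) (P : pred I) :
  \sum_(i : I) \sum_(j : I) (P i != P j : nat) = 2 * (#|P| * (#|I| - #|P|)).
Proof.
have cP : #|I| - #|P| = #|predC P| by rewrite -(cardC P) addKn.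
have E i : \sum_(j : I) (P i != P j : nat) = if P i then #|predC P| else #|P|.
  case: (P i); rewrite -sum1_card [RHS]big_mkcond; apply: eq_bigr => j _;
    by rewrite unfold_in /=; case: (P j).
under eq_bigr do rewrite E.
rewrite (bigID P) /= (eq_bigr (fun=> #|predC P|)) => [|i ->//].
rewrite [X in _ + X](eq_bigr (fun=> #|P|)) => [|i /negbTE ->//].
by rewrite (sum_nat_const P) (sum_nat_const (predC P)) cP [#|predC P| * _]mulnC addnn mul2n.
Qed.

Lemma separated_le k c : c <= k -> 2 * (c * (k - c)) <= (k * k)./2.
Proof.
move=> ck.
have [b ->] : exists b, k = c + b by exists (k - c); rewrite subnKC.
rewrite addKn -[2 * _]doubleK; apply: half_leq.
by rewrite -muln2 mulnC mulnA mulnn; apply: leq_trans (nat_AGM2 c b) _.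
Qed.

Lemma sum_dist_points (H : sgraph) (I : finType) (a : I -> H) : connected H ->
  \sum_(i : I) \sum_(j : I) dist (a i) (a j) <= #|H|.-1 * (#|I| * #|I|)./2.
Proof.
move=> cH; move: {2}#|H| (erefl #|H|) => n; elim: n H cH a => [|n IH] H cH a E.
  by have := card_gt0G cH; rewrite E.
case: n IH E => [|n] IH E.
  rewrite big1 // => i _; rewrite big1 // => j _.
  have /card_le1_eqP h : #|H| <= 1 by rewrite E.
  by rewrite (h (a i) (a j)) ?distxx.
have gt1 : 1 < #|H| by rewrite E.
have [v nv] := exists_noncut cH gt1.
have [u] := card_gt0P (degree_gt0 cH v gt1); rewrite inE => vu.
have uv : u \in [set~ v] by rewrite !inE; apply: contraTneq vu => ->; rewrite adj_irrefl.
pose b i : del v := insubd (exist _ u uv : del v) (a i).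
have bE i : val (b i) = if a i == v then u else a i.
  by rewrite val_insubd !inE; case: eqP.
pose P i := a i == v.
have le i j : dist (a i) (a j) <= dist (b i) (b j) + (P i != P j).
  have hd := induced_dist nv (b i) (b j).
  apply: (@leq_trans (dist (val (b i)) (val (b j)) + (P i != P j))); last by rewrite leq_add2r.
  rewrite !bE /P; case: (eqVneq (a i) v) => [->|_]; case: (eqVneq (a j) v) => [->|_] /=.
  - by rewrite !distxx.
  - by have := dist_tri cH v u (a j); rewrite (dist_adj1 vu) addnC.
  - by have := dist_tri cH (a i) u v; rewrite (dist_sym u v) (dist_adj1 vu).
  - by rewrite addn0.
have cd : #|del v| = n.+1 by rewrite card_del E.
have := IH _ nv b cd; rewrite cd E /= [X in _ -> _ <= X]mulSnr => ih.
apply: (@leq_trans (\sum_i \sum_j dist (b i) (b j) + \sum_i \sum_j (P i != P j : nat))).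
  rewrite -big_split; apply: leq_sum => i _; rewrite -big_split.
  by apply: leq_sum => j _; apply: le.
by apply: leq_add ih _; rewrite sum_separated; apply: separated_le; apply: max_card.
Qed.

Lemma isomorphic_sym (G H : sgraph) : isomorphic G H -> isomorphic H G.
Proof.
case=> f [g fK gK] hf; exists g; first by exists f.
by move=> x y; rewrite -hf !gK.
Qed.

(* The pendants carry no relevant edges: [induced] only serves to make them a type. *)
Notation leaves G := (induced (pendants G)).
Notation core G := (induced (~: pendants G)).

Section Core.
Variables (G : sgraph) (att : leaves G -> core G).
Hypothesis cG : connected G.
Hypothesis att_adj : forall l, adj (val l) (val (att l)).
Let k := #|leaves G|.
Let d := #|core G|.

Lemma leaf_degree (l : leaves G) : degree (val l) = 1.
Proof. by case: l => l /=; rewrite inE => /eqP. Qed.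

Lemma leaf_adj (l : leaves G) y : adj (val l) y -> y = val (att l).
Proof. by move=> ly; apply: (degree1_uniq (leaf_degree l)). Qed.

Lemma card_core : #|G| = d + k.
Proof. by rewrite /d /k !card_induced addnC cardsC. Qed.

(** This weak homomorphism onto the core shows that the core is connected; [c] supplies the default
    that makes [insubd] total. *)
Definition retract (c : core G) (x : G) : core G :=
  if insub x is Some l then att l else insubd c x.

Lemma retract_leaf c (l : leaves G) : retract c (val l) = att l.
Proof. by rewrite /retract valK. Qed.

Lemma retract_core c (h : core G) : retract c (val h) = h.
Proof.
rewrite /retract insubN ?valKd //.
by have := valP h; rewrite inE.
Qed.

Lemma leaf_or_core (x : G) :
  (exists l : leaves G, x = val l) \/ (exists h : core G, x = val h).
Proof.
case: (boolP (x \in pendants G)) => hx; [left|right].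
  by exists (exist _ x hx).
have hx' : x \in ~: pendants G by rewrite inE.
by exists (exist _ x hx').
Qed.

Lemma retract_hom c x y : adj x y ->
  retract c x = retract c y \/ adj (retract c x) (retract c y).
Proof.
case: (leaf_or_core x) => [[l ->]|[h ->]].
  by move/leaf_adj => ->; rewrite retract_leaf retract_core; left.
case: (leaf_or_core y) => [[l ->]|[h' ->]]; last by rewrite !retract_core; right.
by rewrite adj_sym => /leaf_adj ->; rewrite retract_leaf retract_core; left.
Qed.

Lemma core_connected (c : core G) : connected (core G).
Proof.
apply: (weak_hom_connected cG (@retract_hom c)) => h.
by exists (val h); rewrite retract_core.
Qed.

Hypothesis core_gt0 : 0 < d.

Let cH : connected (core G).
Proof. by have /card_gt0P[c _] : 0 < #|core G| := core_gt0; apply: (core_connected c). Qed.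

Lemma sum_leaves_core (F : G -> nat) :
  \sum_(x : G) F x = \sum_(l : leaves G) F (val l) + \sum_(h : core G) F (val h).
Proof.
rewrite (bigID (mem (pendants G))) !sum_induced /=; congr (_ + _).
by apply: eq_bigl => x; rewrite !inE.
Qed.

Let X := \sum_(l : leaves G) \sum_(m : leaves G) dist (att l) (att m).
Let Y := \sum_(l : leaves G) transmission (att l).

(** [X] and [Y] are kept as sums, so that their own cases of equality can be analysed afterwards. *)
Lemma double_wiener_core_le : (wiener G).*2 <=
  (2 * (k * k.-1) + X) + 2 * (k * d + Y) + (wiener (core G)).*2.
Proof.
have leLH (l : leaves G) (h : core G) : dist (val l) (val h) <= 1 + dist (att l) h.
  apply: leq_trans (dist_tri cG _ (val (att l)) _) _.
  by rewrite dist_adj1 // leq_add2l; apply: induced_dist.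
have sLH : \sum_(l : leaves G) \sum_(h : core G) dist (val l) (val h) <= k * d + Y.
  have -> : k * d = \sum_(l : leaves G) d by rewrite sum_nat_const.
  rewrite -big_split; apply: leq_sum => l _ /=.
  have -> : d = \sum_(h : core G) 1 by rewrite sum1_card.
  by rewrite -big_split; apply: leq_sum => h _; apply: leLH.
have sHL : \sum_(h : core G) \sum_(l : leaves G) dist (val h) (val l) <= k * d + Y.
  apply: leq_trans sLH; rewrite exchange_big; apply: leq_sum => l _.
  by apply: leq_sum => h _; rewrite dist_sym.
have sHH : \sum_(h : core G) \sum_(h' : core G) dist (val h) (val h') <=
    (wiener (core G)).*2.
  rewrite wiener_double; apply: leq_sum => h _; apply: leq_sum => h' _.
  exact: induced_dist.
have sLL : \sum_(l : leaves G) \sum_(m : leaves G) dist (val l) (val m) <=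
    2 * (k * k.-1) + X.
  have -> : 2 * (k * k.-1) = \sum_(l : leaves G) \sum_(m : leaves G | m != l) 2.
    rewrite (eq_bigr (fun=> k.-1 * 2)) => [|l _]; first by rewrite sum_nat_const -/k; lia.
    by rewrite (sum_nat_const (predC1 l)) cardC1.
  rewrite -big_split; apply: leq_sum => l _ /=.
  rewrite (bigD1 l) //= distxx add0n [X in _ <= _ + X](bigD1 l) //= distxx add0n.
  rewrite -big_split; apply: leq_sum => m _ /=.
  have := leLH l (att m); have := dist_tri cG (val l) (val (att m)) (val m).
  rewrite (dist_sym (val (att m)) (val m)) (dist_adj1 (att_adj m)) => t1 t2.
  by apply: leq_trans t1 _; move: t2; clear; lia.
rewrite wiener_double sum_leaves_core.
under eq_bigr do rewrite sum_leaves_core.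
under [X in _ + X <= _]eq_bigr do rewrite sum_leaves_core.
rewrite !big_split; apply: leq_trans (leq_add (leq_add sLL sLH) (leq_add sHL sHH)) _.
by clear; lia.
Qed.

(* The first two summands bound the pairs of pendants, the third the pairs made of a
   pendant and a core vertex, the last the pairs of core vertices. *)
Definition broom_bound (k d : nat) :=
  2 * (k * k.-1) + d.-1 * (k * k)./2 + 2 * (k * (d + 'C(d, 2))) + 2 * 'C(d.+1, 3).

(** [X], [Y] and the Wiener index of the core are bounded separately. Equality of the totals makes
    each bound tight, and for [Y] it does so term by term. *)
Lemma double_wiener_broom : (wiener G).*2 <= broom_bound k d /\
  ((wiener G).*2 = broom_bound k d ->
   X = d.-1 * (k * k)./2 /\ forall l, transmission (att l) = 'C(d, 2)).
Proof.
have leX : X <= d.-1 * (k * k)./2 by apply: sum_dist_points.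
have leifY : Y <= k * 'C(d, 2) ?= iff [forall l, transmission (att l) == 'C(d, 2)].
  rewrite -sum_nat_const; apply: leqif_sum => l _.
  by apply: leqif_eq; have [] := transmission_le cH (att l).
have leW := wiener_le_path cH; have := double_wiener_core_le.
have [leY eqY] := leifY; rewrite -/d in leW *.
rewrite /broom_bound mulnDr; split; first by clear eqY; lia.
move=> E; split; first by clear eqY; lia.
suff /forallP h : [forall l, transmission (att l) == 'C(d, 2)] by move=> l; apply/eqP.
by rewrite -eqY; apply/eqP; clear eqY; lia.
Qed.

End Core.

(** * Graphs with a vertex of maximal transmission *)

Section PathFromEnd.
Variables (H : sgraph) (r : H).
Hypothesis cH : connected H.
Hypothesis r_end : transmission r = 'C(#|H|, 2).

Lemma far_path_end j : far r j = #|H|.-1 - j.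
Proof. by have [_] := transmission_le cH r; apply. Qed.

Lemma path_end_inj x y : dist r x = dist r y -> x = y.
Proof.
case dx : (dist r x) => [|j] /esym dy.
  by rewrite -(dist_eq0 (conn cH r x) dx) (dist_eq0 (conn cH r y) dy).
by apply: (layer_inj _ dx dy); rewrite !far_path_end; lia.
Qed.

Lemma path_end_adj x y :
  adj x y = ((dist r x).+1 == dist r y) || ((dist r y).+1 == dist r x).
Proof.
by apply: (@path_layers_adj H r pred0 cH) => // a b _ _; apply: path_end_inj.
Qed.

(** Maximal transmission forces [degree u = 1], while a vertex strictly between [r] and the last
    layer has a neighbour in the layer before and one in the layer after. *)
Lemma path_end_other u : 1 < #|H| -> transmission u = 'C(#|H|, 2) ->
  u = r \/ dist r u = #|H|.-1.
Proof.
move=> gt1 Tu; case du : (dist r u) => [|j].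
  by left; rewrite (dist_eq0 (conn cH r u) du).
right; apply/eqP/negPn/negP => ne.
have lt := dist_lt_card (conn cH r u).
have d1 : degree u = 1.
  have := far1 cH u; have [_ /(_ Tu) ->] := transmission_le cH u.
  have := degree_gt0 cH u gt1; have : degree u < #|H|; last by lia.
  rewrite /degree (cardsD1 u) inE adj_irrefl -cardsT (cardsD1 u setT) inE ltnS.
  by apply: subset_leq_card; apply: setSD; apply: subsetT.
have [z zu dz] := dist_pred (conn cH r u) du.
have : 0 < far r j.+1 by rewrite far_path_end; lia.
case/(layer_gt0 cH)/card_gt0P => y; rewrite inE => /eqP dy.
have uy : adj u y by rewrite path_end_adj du dy eqxx.
have e : y = z by apply: (degree1_uniq d1 uy); rewrite adj_sym.
by move: dy; rewrite e dz; lia.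
Qed.

Lemma exists_path_vertices : exists g : 'I_#|H| -> H, forall i, dist r (g i) = i.
Proof.
apply: (@fin_all_exists _ (fun=> H) (fun (i : 'I_#|H|) x => dist r x = i)) => -[[|j] lt].
  by exists r; rewrite distxx.
have : 0 < far r j by rewrite far_path_end subn_gt0 -ltnS prednK // (leq_ltn_trans _ lt).
by case/(layer_gt0 cH)/card_gt0P => y; rewrite inE => /eqP dy; exists y.
Qed.

End PathFromEnd.

(** Two adjacent pendants form a component by themselves, which cannot contain [c]. *)
Lemma exists_attachment (G : sgraph) (c : G) : connected G -> c \notin pendants G ->
  exists att : leaves G -> core G, forall l, adj (val l) (val (att l)).
Proof.
move=> cG hc.
apply: (@fin_all_exists (leaves G) (fun=> core G) (fun l h => adj (val l) (val h))) => l.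
have /card_gt0P[y] : 0 < degree (val l) by rewrite leaf_degree.
rewrite inE => ly; suff hy : y \in ~: pendants G by exists (exist _ y hy).
rewrite inE; apply/negP => yp.
have d1 x : x \in pendants G -> degree x = 1 by rewrite inE => /eqP.
have := @connect_ind G cG (pred2 (val l) y) (val l) c; rewrite /= eqxx => h.
have /orP[/eqP e|/eqP e] : (c == val l) || (c == y).
- apply: h => // a b ab /orP[/eqP e|/eqP e]; rewrite e in ab.
    by rewrite (degree1_uniq (leaf_degree l) ab ly) eqxx orbT.
  by rewrite (degree1_uniq (d1 y yp) ab (z := val l)) ?eqxx // adj_sym.
- by move: hc; rewrite e (valP l).
by move: hc; rewrite e yp.
Qed.

Section BroomIso.
Variables (G : sgraph) (att : leaves G -> core G) (r : core G).
Hypothesis cG : connected G.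
Hypothesis att_adj : forall l, adj (val l) (val (att l)).
Hypothesis core_gt1 : 1 < #|core G|.
Hypothesis r_end : transmission r = 'C(#|core G|, 2).
Hypothesis att_end : forall l, transmission (att l) = 'C(#|core G|, 2).

Let cH : connected (core G) := core_connected cG att_adj r.
Let A : {set leaves G} := [set l | att l == r].

(** Distance from [r] orders the core as a path. A leaf outside [A] is attached to a vertex of
    maximal transmission other than [r], hence to the opposite end. The bijection is built from the
    broom to [G] and then inverted. *)
Lemma iso_double_broom : isomorphic G (double_broom #|A| #|~: A| #|core G|).
Proof.
have [g hg] := exists_path_vertices cH r_end.
pose f (x : 'I_#|core G| + ('I_#|A| + 'I_#|~: A|)) : G :=
  match x with
  | inl i => val (g i)
  | inr (inl j) => val (enum_val j)
  | inr (inr j) => val (enum_val j)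
  end.
have notin (h : core G) (l : leaves G) : val h <> val l.
  by move=> e; have := valP h; rewrite inE e (valP l).
have injf : injective f.
  move=> [i|[i|i]] [j|[j|j]] //=.
  - by move=> /val_inj e; congr inl; apply: val_inj; rewrite /= -!hg e.
  - by move/notin.
  - by move/notin.
  - by move/esym/notin.
  - by move=> /val_inj/enum_val_inj ->.
  - by move=> /val_inj e; have := enum_valP j; rewrite -e inE enum_valP.
  - by move/esym/notin.
  - by move=> /val_inj e; have := enum_valP i; rewrite e inE enum_valP.
  by move=> /val_inj/enum_val_inj ->.
apply: isomorphic_sym; exists f.
  apply: inj_card_bij => //.
  by rewrite !card_sum !card_ord cardsC (card_core G).
have attE (h : core G) (l : leaves G) : adj (val h) (val l) = (h == att l).
  apply/idP/eqP => [|->]; last by rewrite adj_sym.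
  by rewrite adj_sym => /(leaf_adj att_adj)/val_inj.
have nll (l m : leaves G) : adj (val l) (val m) = false.
  by apply/negP => /(leaf_adj att_adj) /esym /notin.
have gE i : (g i == r) = (i == 0 :> nat).
  apply/eqP/eqP => [e|e]; first by rewrite -hg e distxx.
  by apply: (path_end_inj cH r_end); rewrite hg e distxx.
have gA i (j : 'I_#|A|) : (g i == att (enum_val j)) = (i == 0 :> nat).
  by have := enum_valP j; rewrite inE => /eqP ->; apply: gE.
have gB i (j : 'I_#|~: A|) : (g i == att (enum_val j)) = (i.+1 == #|core G|).
  have := enum_valP j; rewrite !inE => ne.
  have [e|e] := path_end_other cH r_end core_gt1 (att_end (enum_val j)).
    by rewrite e eqxx in ne.
  have -> : (i.+1 == #|core G|) = (i == #|core G|.-1 :> nat) by move: core_gt1; clear; lia.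
  rewrite -e -(hg i); apply/eqP/eqP => [->//|]; exact: (path_end_inj cH r_end).
move=> [i|[i|i]] [j|[j|j]]; rewrite /= /arcs_adj /= ?nll //.
- have := path_end_adj cH r_end (g i) (g j); rewrite /= /induced_adj => ->.
  rewrite !hg.
  have -> : (inl i != inl j :> 'I_#|core G| + ('I_#|A| + 'I_#|~: A|)) =
    (i != j :> nat).
    by [].
  by move: (nat_of_ord i) (nat_of_ord j) => a b; clear; lia.
- by rewrite attE gA orbF.
- by rewrite attE gB orbF.
- by rewrite adj_sym attE gA.
- by rewrite andbF.
- by rewrite adj_sym attE gB.
- by rewrite andbF.
Qed.

End BroomIso.

(** * Balancing the pendants between the two ends *)

Lemma half_add_uphalf k : k./2 + uphalf k = k.
Proof.
rewrite uphalf_half; have := odd_double_half k.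
by move: (k./2) (odd k : nat) => a b; lia.
Qed.

Lemma half_square k : (k * k)./2 = 2 * (k./2 * uphalf k).
Proof.
rewrite -{1 2}(half_add_uphalf k) uphalf_half; case: (odd k); move: (k./2) => m; last first.
  by rewrite add0n -[RHS]doubleK; congr _./2; nia.
have -> : (m + (true + m)) * (m + (true + m)) = true + (2 * (m * (true + m))).*2 by nia.
by rewrite half_bit_double.
Qed.

(** Two pairs with the same sum and the same product agree up to order. *)
Lemma eq_product_split m u p : p <= m + u -> p * (m + u - p) = m * u ->
  p <> m -> p = u.
Proof.
move=> le; have [q E] : exists q, m + u = p + q by exists (m + u - p); rewrite subnKC.
rewrite E addKn; case: (ltngtP p m) => // lt eq _.
  have [a ea] : exists a, m = p + a by exists (m - p); rewrite subnKC // ltnW.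
  have eq_q : q = u + a by lia.
  by apply/eqP; rewrite -(@eqn_pmul2l a); [apply/eqP; subst; nia | lia].
have [a ea] : exists a, p = m + a by exists (p - m); rewrite subnKC // ltnW.
have eq_u : u = q + a by lia.
suff : q = m by lia.
by apply/eqP; rewrite -(@eqn_pmul2l a); [apply/eqP; subst; nia | lia].
Qed.

Lemma max_wiener_pendants (G : sgraph) n k : graph_class n k G -> 1 < k -> k + 2 <= n ->
  (wiener G).*2 <= broom_bound k (n - k) /\
  ((wiener G).*2 = broom_bound k (n - k) ->
   isomorphic G (double_broom k./2 (uphalf k) (n - k))).
Proof.
case=> cG cn ck k2 kn.
have cL : #|leaves G| = k by rewrite card_induced.
have cH : #|core G| = n - k.
  by rewrite card_induced -ck -cn -(cardsC (pendants G)) addKn.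
have core_gt1 : 1 < #|core G| by rewrite cH; lia.
have /card_gt0P[c _] : 0 < #|core G| by lia.
have hc : val c \notin pendants G by have := valP c; rewrite inE.
have [att att_adj] := exists_attachment cG hc.
have := double_wiener_broom cG att_adj (ltnW core_gt1); rewrite cH cL.
case=> le eq; split=> // /eq[EX ET].
have cHc := core_connected cG att_adj c.
pose A r := [set l | att l == r].
have iso l0 : #|A (att l0)| = k./2 ->
    isomorphic G (double_broom k./2 (uphalf k) (n - k)).
  move=> EA; have := @iso_double_broom G att (att l0) cG att_adj core_gt1.
  rewrite cH => /(_ (ET _) ET); rewrite -/(A _) EA.
  suff -> : #|~: A (att l0)| = uphalf k by [].
  have := cardsC (A (att l0)); rewrite cL EA; have := half_add_uphalf k.
  by clear; lia.
have /card_gt0P[l0 _] : 0 < #|leaves G| by lia.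
have T0 : transmission (att l0) = 'C(#|core G|, 2) by rewrite cH.
have ends l : att l = att l0 \/ dist (att l0) (att l) = #|core G|.-1.
  by apply: path_end_other; rewrite // cH.
have far_ne l : dist (att l0) (att l) = #|core G|.-1 -> (att l == att l0) = false.
  by move=> dl; apply/eqP => e; move: dl core_gt1; rewrite e distxx; clear; lia.
set p := #|A (att l0)|.
(* All attachments lie at the two ends of a path, so a pair of leaves contributes the length of the
   path if the ends separate it and 0 otherwise; [EX] then fixes the number of separated pairs. *)
have : 2 * (p * (k - p)) = (k * k)./2.
  have := sum_separated (fun l => att l == att l0).
  rewrite (_ : #|_| = p) ?cL; last by apply: eq_card => l; rewrite !inE.
  move=> <-; apply/eqP; rewrite -(eqn_pmul2l (m := (n - k).-1)); last by lia.
  rewrite -EX big_distrr; apply/eqP/eq_bigr => l _; rewrite big_distrr.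
  apply: eq_bigr => m _ /=; rewrite -cH.
  case: (ends l) => [->|dl]; case: (ends m) => [->|dm]; rewrite ?eqxx ?distxx ?muln0 //.
  - by rewrite dm (far_ne m dm) muln1.
  - by rewrite dist_sym dl (far_ne l dl) muln1.
  have -> : att l = att m by apply: (path_end_inj cHc T0); rewrite dl dm.
  by rewrite eqxx muln0 distxx.
have pk : p <= k by rewrite -cL; apply: max_card.
have hk := odd_double_half k; have huk := half_add_uphalf k.
case: (eqVneq p k./2) => [/iso //|ne] Ep.
have pE : p = uphalf k.
  apply: (@eq_product_split k./2); rewrite ?huk //; last exact/eqP.
  by apply/eqP; rewrite -(eqn_pmul2l (m := 2)) // Ep half_square.
(* Some leaf is at the other end, since [uphalf k < k]; taking that end as root exchanges the two
   halves. *)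
have [l1 l1A] : exists l1, l1 \notin A (att l0).
  apply/existsP; rewrite -negb_forall; apply/negP => /forallP hA.
  have : p = k by rewrite /p -cL; apply: eq_card => l; rewrite hA.
  move: pE huk hk k2 => -> huk hk k2 e; rewrite e in huk.
  by move: huk hk k2; move: (k./2) (odd k) => a []; clear; lia.
apply: (iso l1).
have -> : A (att l1) = ~: A (att l0).
  apply/setP => l; rewrite !inE; rewrite inE in l1A.
  have d1 : dist (att l0) (att l1) = #|core G|.-1.
    by case: (ends l1) => // e; rewrite e eqxx in l1A.
  case: (ends l) => [->|dl]; first by rewrite eqxx eq_sym (negbTE l1A).
  by rewrite (path_end_inj cHc T0 (etrans dl (esym d1))) eqxx.
have := cardsC (A (att l0)); rewrite cL -/p pE; move: huk; clear; lia.
Qed.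

(** * Wiener indices of the extremal graphs *)

Section Levels.
Variables (G : sgraph) (pos : G -> nat) (t : nat).
Hypothesis t_gt0 : 0 < t <= 2.
Hypothesis adjE : forall x y, adj x y =
  [|| (pos x).+1 == pos y, (pos y).+1 == pos x | [&& t == 1, x != y & pos x == pos y]].
Hypothesis between : forall x y p, pos x < p < pos y -> exists z, pos z = p.
Hypothesis twins : forall x y, x != y -> pos x = pos y ->
  exists z, (pos z).+1 = pos y \/ (pos y).+1 = pos z.

(** [pos] places the vertices on a line. Distinct vertices on one level are adjacent when [t] is 1,
    as in the triangles, and joined through a neighbouring level when [t] is 2, as for the leaves of
    a broom. *)
Lemma dist_levels x y : dist x y =
  if x == y then 0 else if pos x == pos y then t else (pos x - pos y) + (pos y - pos x).
Proof.
pose h (x y : G) :=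
  if x == y then 0 else if pos x == pos y then t else (pos x - pos y) + (pos y - pos x).
apply: (@dist_of_potential G h) => {x y} [x y z|x|x y|x y m]; rewrite /h ?eqxx //.
- rewrite adjE; case: (eqVneq x z) => // xz; case: (eqVneq x y) => [<-|xy].
    by rewrite (negbTE xz) /=; case: ifP; lia.
  by do ?case: ifP; lia.
- by case: (eqVneq x y) => // xy; case: eqP; lia.
case: (eqVneq x y) => // xy; case: (ltngtP (pos x) (pos y)) => lt.
- case: (eqVneq (pos x).+1 (pos y)) => [e|ne] E.
    by exists x; rewrite ?eqxx ?adjE ?e ?eqxx //; lia.
  have [|z pz] := @between x y (pos y).-1; first by lia.
  exists z; first by rewrite adjE; lia.
  by case: eqVneq => [xz|_]; [move: pz; rewrite -xz; lia | case: ifP; lia].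
- case: (eqVneq (pos y).+1 (pos x)) => [e|ne] E.
    by exists x; rewrite ?eqxx ?adjE ?e ?eqxx ?orbT //; lia.
  have [|z pz] := @between y x (pos y).+1; first by lia.
  exists z; first by rewrite adjE; lia.
  by case: eqVneq => [xz|_]; [move: pz; rewrite -xz; lia | case: ifP; lia].
move=> E; case: (eqVneq t 1) => [t1|t2].
  by exists x; [rewrite adjE t1 xy lt !eqxx !orbT | rewrite eqxx; lia].
have [z hz] := twins xy lt; exists z; first by rewrite adjE; lia.
by case: eqVneq => [xz|_]; [move: hz; rewrite -xz; lia | case: ifP; lia].
Qed.

End Levels.

Lemma sum_ord_id m : \sum_(i < m) i = 'C(m, 2).
Proof.
elim: m => [|m IH]; first by rewrite big_ord0.
by rewrite big_ord_recr /= IH bin2S addnC.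
Qed.

Lemma sum_ord_succ m : \sum_(i < m) i.+1 = m + 'C(m, 2).
Proof. by have := sum_ord_id m.+1; rewrite (sum_ord_recl id) bin2S. Qed.

Lemma sum_ord_sub m : \sum_(i < m) (m - i) = m + 'C(m, 2).
Proof.
rewrite -sum_ord_succ (reindex_inj rev_ord_inj) /=; apply: eq_bigr => i _.
by have := ltn_ord i; lia.
Qed.

Lemma sum_peel_last (g : nat -> nat -> nat) m :
  \sum_(i < m.+1) \sum_(j < m.+1) g i j =
  \sum_(i < m) \sum_(j < m) g i j + \sum_(i < m) g i m + \sum_(j < m) g m j + g m m.
Proof.
rewrite big_ord_recr /= big_ord_recr /= !addnA; congr (_ + _ + _).
by rewrite -big_split; apply: eq_bigr => i _; rewrite big_ord_recr.
Qed.

Lemma sum_peel_first (g : nat -> nat -> nat) m :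
  \sum_(i < m.+1) \sum_(j < m.+1) g i j =
  g 0 0 + \sum_(j < m) g 0 j.+1 + \sum_(i < m) g i.+1 0 +
  \sum_(i < m) \sum_(j < m) g i.+1 j.+1.
Proof.
rewrite (sum_ord_recl (fun i => \sum_(j < m.+1) g i j)) sum_ord_recl -!addnA.
congr (_ + (_ + _)); rewrite -big_split; apply: eq_bigr => i _.
by rewrite (sum_ord_recl (g i.+1)).
Qed.

Lemma sum_path_dist m :
  \sum_(i < m) \sum_(j < m) ((i - j) + (j - i)) = 2 * 'C(m.+1, 3).
Proof.
elim: m => [|m IH]; first by rewrite big_ord0.
rewrite (sum_peel_last (fun i j => (i - j) + (j - i))) IH (bin3S m.+1) bin2S.
rewrite (eq_bigr (fun i : 'I_m => m - i)) => [|i _]; last by have := ltn_ord i; lia.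
rewrite [X in _ + X + _](eq_bigr (fun i : 'I_m => m - i)) => [|i _].
  by rewrite sum_ord_sub subnn; lia.
by have := ltn_ord i; lia.
Qed.

(** These are the distances from a triangle vertex to a path whose first vertex is its twin: 1 to
    the twin, j to vertex j. *)
Lemma sum_ord_twin m : 0 < m ->
  \sum_(j < m) ((j == 0 :> nat) + j) = 1 + 'C(m, 2).
Proof.
case: m => // m _; rewrite big_split sum_ord_id /=; congr (_ + _).
by rewrite (sum_ord_recl (fun j => j == 0 : nat)) big1.
Qed.

Lemma wiener_lollipop n : 3 < n -> wiener (lollipop n 3) + (n - 2) = 'C(n.+1, 3).
Proof.
(* The triangle vertices 0 and 1 share level 1; peeling off 0 leaves a path on [m] vertices. *)
case: n => // m m3; pose pos i := maxn i 1.
pose g i j := if i == j then 0 else if pos i == pos j then 1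
  else (pos i - pos j) + (pos j - pos i).
have dE (x y : lollipop m.+1 3) : dist x y = g x y.
  rewrite (@dist_levels (lollipop m.+1 3) (fun i : 'I_m.+1 => pos i) 1) //.
  - move=> {}x {}y; rewrite /= /arcs_adj -!val_eqE /= /pos; clear. lia.
  - move=> {}x {}y p lt; have hp : p < m.+1 by have := ltn_ord y; rewrite /pos in lt *; lia.
    by exists (Ordinal hp); rewrite /pos /= in lt *; lia.
  move=> {}x {}y; have h2 : 2 < m.+1 by lia.
  rewrite /pos => ne' e; have ne : x != y :> nat := ne'; exists (Ordinal h2).
  by move: ne e => /=; clear; lia.
apply: double_inj; rewrite doubleD wiener_double.
under eq_bigr do under eq_bigr do rewrite dE.
rewrite (sum_peel_first g).
have -> : \sum_(i < m) \sum_(j < m) g i.+1 j.+1 = 2 * 'C(m.+1, 3).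
  rewrite -sum_path_dist; apply: eq_bigr => i _; apply: eq_bigr => j _.
  by rewrite /g /pos; do ?case: ifP; lia.
have -> : \sum_(j < m) g 0 j.+1 = 1 + 'C(m, 2).
  by rewrite -sum_ord_twin; [apply: eq_bigr => j _; rewrite /g /pos; do ?case: ifP; lia | lia].
have -> : \sum_(j < m) g j.+1 0 = 1 + 'C(m, 2).
  by rewrite -sum_ord_twin; [apply: eq_bigr => j _; rewrite /g /pos; do ?case: ifP; lia | lia].
rewrite (bin3S m.+1) bin2S /g eqxx; lia.
Qed.

Lemma wiener_dumbbell n : 6 < n -> wiener (dumbbell 3 3 n) + 2 * (n - 2) = 'C(n.+1, 3).
Proof.
(* Clamping to the levels 1 to [m] makes 0 the twin of 1 and [m.+1] the twin of [m]; peeling off 0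
   and [m.+1] leaves a path on [m] vertices. *)
case: n => // [[|m]] // m5; pose pos i := minn (maxn i 1) m.
pose g i j := if i == j then 0 else if pos i == pos j then 1
  else (pos i - pos j) + (pos j - pos i).
have dE (x y : dumbbell 3 3 m.+2) : dist x y = g x y.
  rewrite (@dist_levels (dumbbell 3 3 m.+2) (fun i : 'I_m.+2 => pos i) 1) //.
  - move=> {}x {}y; rewrite /= /arcs_adj -!val_eqE /= /pos.
    by have := ltn_ord x; have := ltn_ord y; move: m5; clear; lia.
  - move=> {}x {}y p lt; have hp : p < m.+2 by rewrite /pos in lt *; lia.
    by exists (Ordinal hp); rewrite /pos /= in lt *; lia.
  move=> {}x {}y.
  have h2 : 2 < m.+2 by lia.
  have h3 : m.-1 < m.+2 by lia.
  move=> ne' e; have ne : x != y :> nat := ne'; case: (leqP y 1) => hy.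
    by exists (Ordinal h2); move: ne e hy m5; rewrite /pos /=; clear; lia.
  exists (Ordinal h3); have := ltn_ord x; have := ltn_ord y.
  by move: ne e hy m5; rewrite /pos /=; clear; lia.
apply: double_inj; rewrite doubleD wiener_double.
under eq_bigr do under eq_bigr do rewrite dE.
rewrite (sum_peel_first g) (sum_peel_last (fun i j => g i.+1 j.+1)).
rewrite !(big_ord_recr m).
have -> : \sum_(i < m) \sum_(j < m) g i.+1 j.+1 = 2 * 'C(m.+1, 3).
  rewrite -sum_path_dist; apply: eq_bigr => i _; apply: eq_bigr => j _.
  by have := ltn_ord i; have := ltn_ord j; rewrite /g /pos; clear; do ?case: ifP; lia.
have e1 : \sum_(j < m) g 0 j.+1 = 1 + 'C(m, 2).
  rewrite -sum_ord_twin; [apply: eq_bigr => j _|lia].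
  by have := ltn_ord j; rewrite /g /pos; clear; do ?case: ifP; lia.
have e2 : \sum_(j < m) g j.+1 0 = 1 + 'C(m, 2).
  rewrite -sum_ord_twin; [apply: eq_bigr => j _|lia].
  by have := ltn_ord j; rewrite /g /pos; clear; do ?case: ifP; lia.
have e3 : \sum_(j < m) g j.+1 m.+1 = 1 + 'C(m, 2).
  rewrite -sum_ord_twin; [|lia]; rewrite [RHS](reindex_inj rev_ord_inj) /=.
  apply: eq_bigr => j _; by have := ltn_ord j; rewrite /g /pos; clear; do ?case: ifP; lia.
have e4 : \sum_(j < m) g m.+1 j.+1 = 1 + 'C(m, 2).
  rewrite -sum_ord_twin; [|lia]; rewrite [RHS](reindex_inj rev_ord_inj) /=.
  apply: eq_bigr => j _; by have := ltn_ord j; rewrite /g /pos; clear; do ?case: ifP; lia.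
have [g1 g2] : g 0 m.+1 = m.-1 /\ g m.+1 0 = m.-1.
  by move: m5; rewrite /g /pos; clear; do ?case: ifP; lia.
rewrite /= e1 e2 e3 e4 g1 g2 /g !eqxx (bin3S m.+2) (bin3S m.+1) !bin2S; lia.
Qed.

(** Left leaves, path and right leaves occupy level 0, levels 1 to [d] and level [d.+1]; leaves on
    one side are twins at distance two. *)
Lemma wiener_double_broom a b d : 0 < d ->
  (wiener (double_broom a b d)).*2 =
  2 * (a * a.-1) + 2 * (b * b.-1) + 2 * (a * b * d.+1) +
  2 * ((a + b) * (d + 'C(d, 2))) + 2 * 'C(d.+1, 3).
Proof.
move=> d0; pose pos (x : 'I_d + ('I_a + 'I_b)) :=
  match x with inl i => i.+1 | inr (inl _) => 0 | inr (inr _) => d.+1 end.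
have dE := @dist_levels (double_broom a b d) pos 2 isT.
have {}dE (x y : double_broom a b d) : dist x y = if x == y then 0 else if pos x == pos y then 2
    else (pos x - pos y) + (pos y - pos x).
  apply: dE => {x y} [x y|x y p lt|x y xy].
  - have inlE (i j : 'I_d) : (inl i != inl j :> 'I_d + ('I_a + 'I_b)) = (i != j :> nat).
      by [].
    case: x => [i|[i|i]]; case: y => [j|[j|j]]; rewrite /= /arcs_adj ?inlE /=;
      try (have := ltn_ord i); try (have := ltn_ord j); move: d0; clear;
      rewrite ?andbF ?orbF; lia.
  - have hp : p.-1 < d.
      move: lt; case: x => [i|[i|i]]; case: y => [j|[j|j]];
        try (have := ltn_ord i); try (have := ltn_ord j); move: d0; rewrite /pos; clear; lia.
    by exists (inl (Ordinal hp)); rewrite /=; move: lt; clear; lia.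
  have h0 : 0 < d by []. have h1 : d.-1 < d by lia.
  case: x xy => [i|[i|i]]; case: y => [j|[j|j]] /= xy e.
  - by move: xy; rewrite (_ : i = j) ?eqxx //; apply: val_inj; case: e.
  - by [].
  - by exfalso; have := ltn_ord i; move: e; clear; lia.
  - by [].
  - by exists (inl (Ordinal h0)); right.
  - by [].
  - by exfalso; have := ltn_ord j; move: e; clear; lia.
  - by [].
  by exists (inl (Ordinal h1)); left => /=; lia.
have twin m (K : 'I_m -> double_broom a b d) : injective K ->
    (forall i j, pos (K i) = pos (K j)) ->
    \sum_i \sum_j dist (K i) (K j) = 2 * (m * m.-1).
  move=> iK pK; rewrite (eq_bigr (fun=> m.-1 * 2)) => [|i _].
    by rewrite sum_nat_const card_ord; lia.
  rewrite (bigD1 i) //= distxx add0n.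
  rewrite (eq_bigr (fun=> 2)) => [|j ji].
    by rewrite (sum_nat_const (predC1 i)) cardC1 card_ord.
  by rewrite dE (inj_eq iK) eq_sym (negbTE ji) (pK i j) eqxx.
have sym (I J : finType) (f : I -> double_broom a b d) (g : J -> double_broom a b d) :
    \sum_i \sum_j dist (f i) (g j) = \sum_j \sum_i dist (g j) (f i).
  by rewrite exchange_big; apply: eq_bigr => j _; apply: eq_bigr => i _; apply: dist_sym.
pose vC (i : 'I_d) : double_broom a b d := inl i.
pose vL (i : 'I_a) : double_broom a b d := inr (inl i).
pose vR (i : 'I_b) : double_broom a b d := inr (inr i).
have sLL : \sum_i \sum_j dist (vL i) (vL j) = 2 * (a * a.-1) by apply: twin => // i j [].
have sRR : \sum_i \sum_j dist (vR i) (vR j) = 2 * (b * b.-1) by apply: twin => // i j [].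
have sLR : \sum_i \sum_j dist (vL i) (vR j) = a * b * d.+1.
  rewrite (eq_bigr (fun=> b * d.+1)) => [|i _]; first by rewrite sum_nat_const card_ord mulnA.
  rewrite (eq_bigr (fun=> d.+1)) => [|j _]; first by rewrite sum_nat_const card_ord.
  by rewrite dE /= sub0n subn0.
have sLC : \sum_i \sum_j dist (vL i) (vC j) = a * (d + 'C(d, 2)).
  rewrite (eq_bigr (fun=> d + 'C(d, 2))) => [|i _]; first by rewrite sum_nat_const card_ord.
  by rewrite -sum_ord_succ; apply: eq_bigr => j _; rewrite dE /= sub0n subn0.
have sRC : \sum_i \sum_j dist (vR i) (vC j) = b * (d + 'C(d, 2)).
  rewrite (eq_bigr (fun=> d + 'C(d, 2))) => [|i _]; first by rewrite sum_nat_const card_ord.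
  rewrite -sum_ord_sub; apply: eq_bigr => j _; have := ltn_ord j; rewrite dE /=.
  by clear; case: ifP; lia.
have sCC : \sum_i \sum_j dist (vC i) (vC j) = 2 * 'C(d.+1, 3).
  rewrite -sum_path_dist; apply: eq_bigr => i _; apply: eq_bigr => j _; rewrite dE /=.
  have -> : (vC i == vC j) = (i == j :> nat) by [].
  by clear; do ?case: ifP; lia.
have split3 (F : double_broom a b d -> nat) :
    \sum_x F x = \sum_i F (vC i) + (\sum_i F (vL i) + \sum_i F (vR i)).
  by rewrite big_sumType big_sumType.
rewrite wiener_double split3.
under eq_bigr do rewrite split3.
under [X in _ + (X + _)]eq_bigr do rewrite split3.
under [X in _ + (_ + X)]eq_bigr do rewrite split3.
rewrite !big_split /= (sym _ _ vC vL) (sym _ _ vC vR) (sym _ _ vR vL).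
rewrite sLL sRR sLR sLC sRC sCC; lia.
Qed.

Lemma double_broom_bound k d : 0 < d ->
  (wiener (double_broom k./2 (uphalf k) d)).*2 = broom_bound k d.
Proof.
move=> d0; rewrite wiener_double_broom // /broom_bound half_square.
move: (half_add_uphalf k); move: (k./2) (uphalf k) => u v <-.
case: d d0 => // d _; move: (d.+1 + 'C(d.+1, 2)) 'C(d.+2, 3) => X Y.
(* Splitting off zero turns the truncated predecessors into polynomials. *)
by case: u v => [|u] [|v]; rewrite ?addn0 ?add0n ?addSn /= ?muln0 ?mul0n; ring.
Qed.

(** * Closed forms over the rationals, and the theorem *)

Local Open Scope ring_scope.

Lemma bin2_rat m : ('C(m.+1, 2))%:R = (m%:R + 1) * m%:R / 2 :> rat.
Proof.
have h := bin_ffact m.+1 2; rewrite !ffactnS ffactn0 muln1 /= in h.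
have : ('C(m.+1, 2) * 2)%:R = (m.+1 * m)%:R :> rat by rewrite -h.
by rewrite !natrM -natr1 => e; apply: (mulIf (x := 2)); rewrite // e; field.
Qed.

Lemma bin3_rat m : ('C(m.+2, 3))%:R = (m%:R + 2) * (m%:R + 1) * m%:R / 6 :> rat.
Proof.
have h := bin_ffact m.+2 3; rewrite !ffactnS ffactn0 muln1 /= in h.
have : ('C(m.+2, 3) * 6)%:R = (m.+2 * (m.+1 * m))%:R :> rat by rewrite -h.
by rewrite !natrM -!natr1 => e; apply: (mulIf (x := 6)); rewrite // e; field.
Qed.

(** Using the parity as a number treats both cases at once: (k^2 - [odd k]) / 4 is the product of
    the two halves of [k]. *)
Lemma wiener_double_broom_rat (k d : nat) : (0 < d)%N ->
  (wiener (double_broom k./2 (uphalf k) d))%:R =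
    ('C(d + 1, 3))%:R + (k%:R ^+ 2 - (odd k)%:R) / 4 * (d%:R + 3)
    + k%:R / 2 * (d%:R ^+ 2 + d%:R - 2) + (odd k)%:R :> rat.
Proof.
case: d => // d _; have := @double_broom_bound k d.+1 isT.
rewrite /broom_bound half_square addn1 succnK.
have hk : k%:R = (k./2)%:R *+ 2 + (odd k)%:R :> rat.
  by rewrite -{1}(odd_double_half k) addnC natrD -muln2 natrM mulr_natr.
have hu : (uphalf k)%:R = (k./2)%:R + (odd k)%:R :> rat.
  by rewrite uphalf_half addnC natrD.
have hp : (k * k.-1)%N%:R = k%:R * (k%:R - 1) :> rat.
  by case: (k) => [|m]; rewrite ?mul0r // natrM -natr1 addrK.
have cast (w x y z t : nat) : (w.*2 = x + y + z + t)%N ->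
    w%:R * 2 = x%:R + y%:R + z%:R + t%:R :> rat.
  by move=> e; rewrite -natrM muln2 e !natrD.
move/cast; rewrite (natrM rat 2 (k * k.-1)) hp !natrM natrD bin2_rat hu hk -(natr1 d).
move: (wiener _)%:R ('C(_, _))%:R (k./2)%:R d%:R => W C u e E.
by apply: (mulIf (x := 2)) => //; rewrite E; case: (odd k) => /=; field.
Qed.

Local Close Scope ring_scope.

Theorem theorem1p1 (n k : nat) (hk : (k + 2 <= n)%N) :
  [/\ (2 <= k)%N ->
      [/\ forall G : sgraph, graph_class n k G ->
            (wiener G <= wiener (double_broom k./2 (uphalf k) (n - k)))%N /\
            (wiener G = wiener (double_broom k./2 (uphalf k) (n - k)) <->
             isomorphic G (double_broom k./2 (uphalf k) (n - k))),
          ~~ odd k ->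
            ((wiener (double_broom k./2 (uphalf k) (n - k)))%:R =
             ('C(n - k + 1, 3))%:R
             + k%:R ^+ 2 / 4 * (n%:R - k%:R + 3)
             + k%:R / 2 * ((n%:R - k%:R) ^+ 2 + n%:R - k%:R - 2)
             :> rat)%R
        & odd k ->
            ((wiener (double_broom k./2 (uphalf k) (n - k)))%:R =
             ('C(n - k + 1, 3))%:R
             + (k%:R ^+ 2 - 1) / 4 * (n%:R - k%:R + 3)
             + k%:R / 2 * ((n%:R - k%:R) ^+ 2 + n%:R - k%:R - 2) + 1
             :> rat)%R],
      k = 1%N -> (4 <= n)%N ->
      (forall G : sgraph, graph_class n k G ->
         (wiener G <= wiener (lollipop n 3))%N /\
         (wiener G = wiener (lollipop n 3) <-> isomorphic G (lollipop n 3))) /\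
      ((wiener (lollipop n 3))%:R = (n%:R ^+ 3 - 7 * n%:R + 12) / 6 :> rat)%R
    & k = 0%N -> (7 <= n)%N ->
      (forall G : sgraph, graph_class n k G ->
         (wiener G <= wiener (dumbbell 3 3 n))%N /\
         (wiener G = wiener (dumbbell 3 3 n) <->
          isomorphic G (dumbbell 3 3 n))) /\
      ((wiener (dumbbell 3 3 n))%:R = (n%:R ^+ 3 - 13 * n%:R + 24) / 6
       :> rat)%R].
Proof.
split.
- move=> k2; have d0 : 0 < n - k by lia.
  have dR : ((n - k)%:R = n%:R - k%:R :> rat)%R by rewrite natrB //; lia.
  split; last 2 first.
  + by move=> /negbTE ek; rewrite wiener_double_broom_rat // ek dR /=; field.
  + by move=> ok; rewrite wiener_double_broom_rat // ok dR /=; field.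
  move=> G GC; have [le eq] := max_wiener_pendants GC k2 hk.
  rewrite -leq_double double_broom_bound //; split=> //; split=> [E|].
    by apply: eq; rewrite E double_broom_bound.
  exact: isomorphic_wiener.
- move=> k1 n4; have E := wiener_lollipop n4; split.
    move=> G; rewrite k1 => GC; have [le eq] := max_wiener_one_pendant GC n4.
    split; first by lia.
    by split=> [e|]; [apply: eq; rewrite e | apply: isomorphic_wiener].
  have : ((wiener (lollipop n 3) + (n - 2))%:R = ('C(n.+1, 3))%:R :> rat)%R by rewrite E.
  (* This is the shape required by [bin3_rat], with m = n - 1. *)
  have -> : n.+1 = (n - 1).+2 by lia.
  rewrite natrD bin3_rat !natrB; [|lia..].
  by move/(canRL (addrK _)) => ->; field.
move=> k0 n7; have E := wiener_dumbbell n7; split.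
  move=> G; rewrite k0 => GC; have [le eq] := max_wiener_no_pendant GC n7.
  split; first by lia.
  by split=> [e|]; [apply: eq; rewrite e | apply: isomorphic_wiener].
have : ((wiener (dumbbell 3 3 n) + 2 * (n - 2))%:R = ('C(n.+1, 3))%:R :> rat)%R by rewrite E.
have -> : n.+1 = (n - 1).+2 by lia.
rewrite natrD natrM bin3_rat !natrB; [|lia..].
by move/(canRL (addrK _)) => ->; field.
Qed.
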